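(* Let $\lambda,\mu,\nu$ be partitions and let $n_1,n_2\ge2$ be integers with $\ell(\lambda)\le n_1$, $\ell(\mu)\le n_2$ and $\ell(\nu)\le n_1n_2+n_1+n_2$. Then the sequence $\big(a_{\lambda+(d),\mu+(d)}^{\nu+(d)}\big)_{d\in\mathbb{Z}_{\ge0}}$ is constant when $$d\ge-\lambda_1-\mu_1+\nu_1+2\nu_2+\sum_{k=1}^{n_1+n_2-1}\nu_{k+2}.$$
   Context: All representations are complex. A partition $\lambda=(\lambda_1\ge\dots\ge\lambda_n>0)$ is a finite non-increasing sequence of positive integers (possibly empty); $|\lambda|$ is the sum of its parts, $\ell(\lambda)$ its number of parts, and $\lambda_i=0$ for $i>\ell(\lambda)$. Partitions are added componentwise; $(d)$ is the partition with single part $d$ (empty if $d=0$). For a partition $\lambda$ of $k$, $M_\lambda$ denotes the irreducible complex representation of the symmetric group $\mathfrak{S}_k$ corresponding to $\lambda$ (Specht module). For $a,b\ge0$ let $\iota_{a,b}:\mathfrak{S}_a\times\mathfrak{S}_b\hookrightarrow\mathfrak{S}_{a+b}$ be the standard embedding ($\mathfrak{S}_a$ permutes $\{1,\dots,a\}$, $\mathfrak{S}_b$ permutes $\{a+1,\dots,a+b\}$). Heisenberg product: let $V$, $W$ be representations of $\mathfrak{S}_k$, $\mathfrak{S}_l$. For $i\in\{\max(k,l),\dots,k+l\}$ put $H_i=\mathfrak{S}_{i-l}\times\mathfrak{S}_{k+l-i}\times\mathfrak{S}_{i-k}$, embedded in $\mathfrak{S}_k\times\mathfrak{S}_l$ by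 $(\sigma,\tau,\rho)\mapsto(\iota_{i-l,k+l-i}(\sigma,\tau),\iota_{k+l-i,i-k}(\tau,\rho))$ and in $\mathfrak{S}_i$ by $(\sigma,\tau,\rho)\mapsto\iota_{i-l,l}(\sigma,\iota_{k+l-i,i-k}(\tau,\rho))$. Then $(V\sharp W)_i=\mathrm{Ind}_{H_i}^{\mathfrak{S}_i}\mathrm{Res}^{\mathfrak{S}_k\times\mathfrak{S}_l}_{H_i}(V\otimes W)$ and $V\sharp W=\bigoplus_{i=\max(k,l)}^{k+l}(V\sharp W)_i$. Aguiar coefficients: for $\lambda\vdash k$, $\mu\vdash l$ the non-negative integers $a_{\lambda,\mu}^\nu$ are the multiplicities in $M_\lambda\sharp M_\mu=\bigoplus_{i=\max(k,l)}^{k+l}\bigoplus_{\nu\vdash i}M_\nu^{\oplus a_{\lambda,\mu}^\nu}$; by convention $a_{\lambda,\mu}^\nu=0$ if $|\nu|\notin\{\max(|\lambda|,|\mu|),\dots,|\lambda|+|\mu|\}$. *)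

(* Defs.v *)
From HB Require Import structures.
From mathcomp Require Import all_boot all_order all_algebra all_fingroup.
From mathcomp Require Import all_solvable all_field all_character.

Set Implicit Arguments.
Unset Strict Implicit.
Unset Printing Implicit Defensive.

Import Order.TTheory GRing.Theory Num.Theory.
Local Open Scope ring_scope.

(* Partitions are finite sequences; [part lam i] is the part lambda_i with the
   usual 1-based index (it is meant for 0 < i), and is 0 beyond the length. *)
Definition is_part (lam : seq nat) : bool := sorted geq lam && (0%N \notin lam).

Definition part (lam : seq nat) (i : nat) : nat := nth 0%N lam i.-1.

Definition part_add (lam mu : seq nat) : seq nat :=
  mkseq (fun i => nth 0 lam i + nth 0 mu i)%N (maxn (size lam) (size mu)).

Definition part_row (d : nat) : seq nat := if d == 0%N then [::] else [:: d].

Lemma is_part_row d : is_part (part_row d).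
Proof. by case: d. Qed.

Lemma part_add_part lam mu i :
  (0 < i)%N -> part (part_add lam mu) i = (part lam i + part mu i)%N.
Proof.
case: i => // i _; rewrite /part /part_add /=.
case: (ltnP i (maxn (size lam) (size mu))) => hi; first by rewrite nth_mkseq.
by move: (hi); rewrite geq_max => /andP[h1 h2]; rewrite !nth_default ?size_mkseq.
Qed.

(* The Specht module of a partition lam of n. The boxes of the Young diagram
   of lam are numbered 0, 1, ..., n - 1 along the successive rows, so that
   number i sits in row [reshape_index lam i] and column
   [reshape_offset lam i]. Since [(s * t) x = t (s x)] in MathComp, modules are
   right modules: [v *m regular_repr _ _ g] is the product v g in the group
   ring. The module is the right ideal generated by the Young symmetrizer.
   These definitions are only meaningful when n = sumn lam; keeping n separate
   spares casts between symmetric groups of equal degree. *)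
Section Specht.

Variables (n : nat) (lam : seq nat).

Definition row_group : {set 'S_n} :=
  [set s : 'S_n | [forall i, reshape_index lam (s i) == reshape_index lam i]].

Definition col_group : {set 'S_n} :=
  [set s : 'S_n | [forall i, reshape_offset lam (s i) == reshape_offset lam i]].

Definition young_symmetrizer : 'rV[algC]_#|[set: 'S_n]| :=
  \sum_(s in row_group) \sum_(t in col_group)
    (-1) ^+ odd_perm t *: delta_mx 0 (gring_index [set: 'S_n] (s * t)%g).

Definition specht_repr :=
  submod_repr (cyclic_mx_module (regular_repr algC [set: 'S_n])
                                young_symmetrizer).

Definition specht_char : 'CF([set: 'S_n]) := cfRepr specht_repr.

End Specht.

Section BlockEmbedding.

Variables a b : nat.

Definition block_fun (u : 'S_a * 'S_b) (i : 'I_(a + b)) : 'I_(a + b) :=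
  match split i with
  | inl j => lshift b (u.1 j)
  | inr j => rshift a (u.2 j)
  end.

Lemma block_fun_inj u : injective (block_fun u).
Proof.
move=> i j; rewrite -[i]splitK -[j]splitK /block_fun !unsplitK.
case: (split i) => i'; case: (split j) => j' /= /eqP;
  rewrite ?eq_shift // => /eqP /perm_inj -> //.
Qed.

Definition iota_perm (u : 'S_a * 'S_b) : 'S_(a + b) := perm (@block_fun_inj u).

Lemma iota_perm_lshift u i : iota_perm u (lshift b i) = lshift b (u.1 i).
Proof. by rewrite permE /block_fun -[lshift b i]/(unsplit (inl i)) unsplitK. Qed.

Lemma iota_perm_rshift u i : iota_perm u (rshift a i) = rshift a (u.2 i).
Proof. by rewrite permE /block_fun -[rshift a i]/(unsplit (inr i)) unsplitK. Qed.

Lemma iota_permM : {morph iota_perm : u v / (u * v)%g}.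
Proof.
move=> u v; apply/permP=> i; rewrite permM -[i]splitK.
by case: (split i) => j /=;
   rewrite ?(iota_perm_lshift, iota_perm_rshift) permM.
Qed.

Lemma iota_perm_inj : injective iota_perm.
Proof.
move=> [s t] [s' t'] /permP h; congr (_, _); apply/permP=> i.
  by have := h (lshift b i); rewrite !iota_perm_lshift => /lshift_inj.
by have := h (rshift a i); rewrite !iota_perm_rshift => /rshift_inj.
Qed.

End BlockEmbedding.

(* Restriction along a group morphism f, and induction along an injective one;
   'Res and 'Ind of MathComp only handle inclusions of subgroups. *)
Definition cf_pullback (aT rT : finGroupType) (f : {morphism [set: aT] >-> rT})
    (phi : 'CF([set: rT])) : 'CF([set: aT]) :=
  cfMorph ('Res[f @* [set: aT]] phi).

Lemma cf_pullbackE (aT rT : finGroupType) (f : {morphism [set: aT] >-> rT}) phi x :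
  cf_pullback f phi x = phi (f x).
Proof. by rewrite cfMorphE ?inE // cfResE ?subsetT // mem_morphim ?inE. Qed.

Lemma cf_pullback_char (aT rT : finGroupType) (f : {morphism [set: aT] >-> rT}) phi :
  phi \is a character -> cf_pullback f phi \is a character.
Proof. by move=> ?; rewrite cfMorph_char ?cfRes_char. Qed.

Definition cf_pushforward (aT rT : finGroupType)
    (f : {morphism [set: aT] >-> rT}) (f_inj : ('injm f)%g)
    (phi : 'CF([set: aT])) : 'CF([set: rT]) :=
  'Ind[[set: rT]] (cfIsom (sub_isom (subxx [set: aT]) (erefl (f @* [set: aT])%g) f_inj) phi).

Lemma cf_pushforward_char (aT rT : finGroupType) (f : {morphism [set: aT] >-> rT})
    (f_inj : ('injm f)%g) phi :
  phi \is a character -> cf_pushforward f_inj phi \is a character.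
Proof. by move=> ?; rewrite cfInd_char ?cfIsom_char. Qed.

(* The character of the external tensor product of representations. *)
Definition cf_tensor (gT hT : finGroupType)
    (phi : 'CF([set: gT])) (psi : 'CF([set: hT])) : 'CF([set: gT * hT]) :=
  cf_pullback (fst_morphism gT hT) phi * cf_pullback (snd_morphism gT hT) psi.

Lemma cf_tensorE (gT hT : finGroupType) (phi : 'CF([set: gT]))
    (psi : 'CF([set: hT])) u : cf_tensor phi psi u = phi u.1 * psi u.2.
Proof. by rewrite cfunE !cf_pullbackE. Qed.

Lemma cf_tensor_char (gT hT : finGroupType) (phi : 'CF([set: gT]))
    (psi : 'CF([set: hT])) :
  phi \is a character -> psi \is a character ->
  cf_tensor phi psi \is a character.
Proof. by move=> ? ?; rewrite rpredM ?cf_pullback_char. Qed.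

(* The Heisenberg product. With p = i - l, q = k + l - i and r = i - k, we have
   k = p + q, l = q + r, i = p + (q + r), and H_i = S_p x S_q x S_r. *)
Section Heisenberg.

Variables p q r : nat.

Local Notation H := ('S_p * 'S_q * 'S_r)%type.

Definition heis_source (u : H) : 'S_(p + q) * 'S_(q + r) :=
  (iota_perm (u.1.1, u.1.2), iota_perm (u.1.2, u.2)).

Definition heis_target (u : H) : 'S_(p + (q + r)) :=
  iota_perm (u.1.1, iota_perm (u.1.2, u.2)).

Lemma heis_sourceM : {morph heis_source : u v / (u * v)%g}.
Proof. by move=> u v; congr (_, _); rewrite -iota_permM. Qed.

Lemma heis_targetM : {morph heis_target : u v / (u * v)%g}.
Proof. by move=> u v; rewrite /heis_target -iota_permM; congr iota_perm;
  congr (_, _); rewrite -iota_permM. Qed.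

Definition heis_source_morphism : {morphism [set: H] >-> _} :=
  Morphism (in2W heis_sourceM).

Definition heis_target_morphism : {morphism [set: H] >-> _} :=
  Morphism (in2W heis_targetM).

Lemma heis_target_injm : ('injm heis_target_morphism)%g.
Proof.
apply/injmP=> [[[s t] u]] [[s' t'] u'] _ _ /= /iota_perm_inj [-> /iota_perm_inj].
by case=> -> ->.
Qed.

(* The degree i component, i = p + (q + r), of the Heisenberg product. *)
Definition heisenberg (V : 'CF([set: 'S_(p + q)])) (W : 'CF([set: 'S_(q + r)])) :
    'CF([set: 'S_(p + (q + r))]) :=
  cf_pushforward heis_target_injm
    (cf_pullback heis_source_morphism (cf_tensor V W)).

Lemma heisenberg_char V W :
  V \is a character -> W \is a character -> heisenberg V W \is a character.
Proof.
by move=> ? ?; rewrite cf_pushforward_char ?cf_pullback_char ?cf_tensor_char.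
Qed.

(* The multiplicity of M_nu in the degree p + (q + r) component of the
   Heisenberg product of M_lam and M_mu. *)
Definition heis_mult (lam mu nu : seq nat) : nat :=
  Num.truncn '[heisenberg (specht_char (p + q) lam) (specht_char (q + r) mu),
               specht_char (p + (q + r)) nu].

(* The truncation above does not lose anything. *)
Lemma heis_multE lam mu nu : (heis_mult lam mu nu)%:R =
  '[heisenberg (specht_char (p + q) lam) (specht_char (q + r) mu),
    specht_char (p + (q + r)) nu].
Proof.
by rewrite truncnK // Cnat_cfdot_char ?heisenberg_char // cfRepr_char.
Qed.

End Heisenberg.

Definition aguiar (lam mu nu : seq nat) : nat :=
  let k := sumn lam in let l := sumn mu in let i := sumn nu in
  if (maxn k l <= i <= k + l)%N
  then heis_mult (i - l) (k + l - i) (i - k) lam mu nu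
  else 0%N.

(* Main.v *)
Require Import Defs.
From mathcomp Require Import all_boot all_order all_algebra all_fingroup.
From mathcomp Require Import all_field all_character.
From mathcomp Require Import mpoly zify.

(** The Aguiar coefficients are alternating sums of Kostka-like numbers, each of
    which stops changing for an elementary reason.

    _From representations to numbers._  For a content [c] (a prescribed number
    of occurrences of each letter), let [permc m c] be the permutation character
    of the symmetric group on the words of length [m] with content [c].  With
    [rho] the staircase (n - 1, ..., 1, 0), the determinantal formula

      chi_lam = sum over w of sgn w * permc (w (lam + rho) - rho)

    ([specht_char_frob]) reduces everything to permutation characters.  The
    Heisenberg product of two of these is again a sum of permutation characters:
    a word in the letters x_1, x_2, ... glued to a word in y_1, y_2, ... along
    an overlap is a word in the alphabet formed by the x_i, the y_j and the
    pairs x_i y_j ([heisenberg_permc]).  Hence ([aguiar_formula]) the coefficient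
    a_(lam, mu)^nu is a signed sum, over two permutations w1 and w2, of the
    number of semistandard tableaux of shape nu in that alphabet whose total
    x-content is w1 (lam + rho) - rho and whose total y-content is
    w2 (mu + rho) - rho ([weight_count]).

    _The determinantal formula._  The inner product of the right hand side with
    [permc m g] is the coefficient of x^(lam + rho) in the Vandermonde alternant
    times the product of the complete symmetric polynomials h_(g b)
    ([cfdot_frob]).  Pieri's rule ([pieri]) makes this coefficient, called
    [kostka] below, computable; it gives the right hand side norm 1.  On the
    other side, the right ideal a b A generated by a Young symmetrizer lies
    inside a A, whose character is [permc] of lam, and is a quotient of b A,
    whose character is sgn times [permc] of the conjugate partition; those two
    characters have inner product at most 1, because at most one zero-one matrix
    has row sums lam and column sums lam'.  So the Specht character is
    irreducible, its inner product with the virtual character on the right is 1,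
    and the two agree ([char_eq_frob]).

    _Stability._  Adding 1 to lam_1, mu_1 and nu_1 adds one letter x_i and one
    letter y_j to the contents, where w1 sends i and w2 sends j to the first
    index.  Adding one letter x_i y_j to the first row of a tableau (for an
    order of the alphabet that starts with this letter) does this.  It is a
    bijection as soon as the new tableaux have more than nu_2 letters x_i y_j
    ([kostka_first_part_add]).  There are n1 + n2 + 1 letters that involve x_i
    or y_j; put first in the order, they only occupy the first n1 + n2 + 1 rows,
    so there are at most nu_1 + ... + nu_(n1 + n2 + 1) + d of them in shape
    nu + (d); but x_i and y_j together occur at least lam_1 + mu_1 + 2 d times,
    which forces many letters x_i y_j.  Comparing with nu_2 gives exactly the
    bound of the theorem ([weight_count_stable]). *)

Set Implicit Arguments.
Unset Strict Implicit.
Unset Printing Implicit Defensive.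

Import Order.TTheory GRing.Theory Num.Theory.
Local Open Scope ring_scope.

(** * Alternants, complete symmetric polynomials and Pieri's rule *)

Lemma sum_sign_reversing (I : finType) (P : pred I) (F : I -> algC) (t : I -> I) :
  (forall x, P x -> [/\ P (t x), t (t x) = x & F (t x) = - F x]) ->
  \sum_(x | P x) F x = 0.
Proof.
move=> ht; set S := \sum_(x | P x) F x.
have hS : S = - S.
  rewrite {1}/S (reindex_onto t t) => [|x /ht[]//].
  rewrite /S -sumrN; apply: eq_big => [x | x].
    apply/andP/idP => [[Ptx /eqP ttx]|/ht[-> -> _] //].
    by have [] := ht _ Ptx; rewrite ttx.
  by move=> /andP[Ptx /eqP ttx]; have [_ _] := ht _ Ptx; rewrite ttx => ->; rewrite opprK.
have /eqP : S *+ 2 = 0 by rewrite mulr2n {2}hS subrr.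
by rewrite mulrn_eq0 => /eqP.
Qed.

Section Alternants.

Variable n : nat.
Implicit Types (m k v : 'X_{1..n}) (q p : {mpoly algC[n]}) (s w : 'S_n).

Definition mnm_act m s : 'X_{1..n} := [multinom m (s i) | i < n].

Lemma mnm_actE m s i : mnm_act m s i = m (s i).
Proof. by rewrite mnmE. Qed.

Lemma mnm_actM m s w : mnm_act m (s * w) = mnm_act (mnm_act m w) s.
Proof. by rewrite /mnm_act mpermM. Qed.

Lemma mnm_act1 m : mnm_act m 1 = m.
Proof. by rewrite /mnm_act mperm1. Qed.

Lemma mdeg_mnm_act m s : mdeg (mnm_act m s) = mdeg m.
Proof. exact: mdeg_mperm. Qed.

(** The staircase: strictly decreasing exponents are the sums of [rho] and a partition. *)
Definition rho : 'X_{1..n} := [multinom (n - i.+1)%N | i < n].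

Lemma rhoE i : rho i = (n - i.+1)%N.
Proof. by rewrite mnmE. Qed.

(** Complete homogeneous symmetric polynomials, as sums of monomials. *)
Definition hpoly (c : nat) : {mpoly algC[n]} :=
  \sum_(v : 'X_{1..n < c.+1} | mdeg v == c) 'X_[v].

Lemma mcoeff_hpoly c m : (hpoly c)@_m = (mdeg m == c)%:R.
Proof.
rewrite /hpoly raddf_sum /=; under eq_bigr do rewrite mcoeffX.
case: eqP => [e|ne].
  have hm : (mdeg m < c.+1)%N by rewrite e.
  rewrite (bigD1 (BMultinom hm)) /= ?e ?eqxx // big1 ?addr0 // => v /andP[_].
  by rewrite -val_eqE /= => /negbTE ->.
rewrite big1 // => v /eqP hv; case: eqP => // e; case: ne; by rewrite -e.
Qed.

Lemma hpoly_sym c : hpoly c \is symmetric.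
Proof.
apply/issymP=> s; apply/mpolyP=> m.
by rewrite mcoeff_sym !mcoeff_hpoly mdeg_mperm.
Qed.

Definition antisymmetric_poly q := forall s, msym s q = (-1) ^+ s *: q.

Lemma antisym_coeff q s m :
  antisymmetric_poly q -> q@_(mnm_act m s) = (-1) ^+ s * q@_m.
Proof. by move=> hq; rewrite -mcoeffZ -hq mcoeff_sym. Qed.

Lemma antisym_symM p q :
  p \is symmetric -> antisymmetric_poly q -> antisymmetric_poly (p * q).
Proof. by move=> /issymP hp hq s; rewrite msymM hp hq -scalerAr. Qed.

(** The Vandermonde determinant in the form of an antisymmetrized monomial. *)
Definition alternant : {mpoly algC[n]} :=
  \sum_(w : 'S_n) (-1) ^+ w *: msym w 'X_[rho].

Lemma alternant_antisym : antisymmetric_poly alternant.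
Proof.
move=> s; rewrite /alternant raddf_sum scaler_sumr /=.
rewrite (reindex_inj (mulIg s^-1%g)) /=; apply: eq_bigr => w _.
rewrite msymZ -msymMm mulgKV odd_permM odd_permV signr_addb scalerA.
by rewrite mulrC.
Qed.

Definition strict k := forall i j : 'I_n, (i < j)%N -> (k j < k i)%N.

(** Subtracting [rho] from both sides, this says that the skew shape between [m] and
    [k] is a horizontal strip; in these shifted coordinates the inequality is strict. *)
Definition interlace m k :=
  [forall i, (m i <= k i)%N && [forall j : 'I_n, (i < j)%N ==> (k j < m i)%N]].

Lemma interlaceP m k :
  reflect ((forall i, m i <= k i)%N /\ forall i j : 'I_n, (i < j)%N -> (k j < m i)%N)
          (interlace m k).
Proof.
apply: (iffP forallP) => [h|[h1 h2] i].
  split=> [i|i j ij]; first by case/andP: (h i).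
  by case/andP: (h i) => _ /forallP/(_ j)/implyP/(_ ij).
by rewrite h1; apply/forallP=> j; apply/implyP=> /h2.
Qed.

Lemma interlace_strict m k : interlace m k -> strict m.
Proof.
by case/interlaceP=> h1 h2 i j ij; apply: leq_ltn_trans (h1 j) (h2 _ _ ij).
Qed.

Lemma mcoeff_hpolyM N c q k : (mdeg k < N)%N ->
  (hpoly c * q)@_k =
  \sum_(m : 'X_{1..n < N} | (m <= k)%MM && (mdeg m + c == mdeg k)%N) q@_m.
Proof.
move=> kN; rewrite (mcoeff_poly_mul _ _ kN).
rewrite -(pair_big_dep xpredT (fun a b : 'X_{1..n < N} => k == (a + b)%MM)
            (fun a b => (hpoly c)@_a * q@_b)) /=.
rewrite (exchange_big_dep xpredT) //= [RHS]big_mkcond; apply: eq_bigr => b _.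
case: (boolP (b <= k)%MM) => hb /=; last first.
  rewrite big1 // => a /eqP e; case/negP: hb; rewrite e.
  by apply/mnm_lepP=> i; rewrite mnmDE leq_addl.
have hd : (mdeg k = mdeg (k - b)%MM + mdeg b)%N by rewrite -mdegD submK.
have ha : (mdeg (k - b)%MM < N)%N by apply: leq_ltn_trans kN; rewrite hd leq_addr.
rewrite (bigD1 (BMultinom ha)) /= ?submK // big1 ?addr0 => [|a /andP[/eqP e]].
  rewrite mcoeff_hpoly (_ : (mdeg b + c == mdeg k)%N = (mdeg (k - b)%MM == c)).
    by case: eqP; rewrite ?mul1r ?mul0r.
  by apply/eqP/eqP; lia.
by rewrite -val_eqE /= => /eqP[]; rewrite e addmK.
Qed.

Definition bmnm_act N (m : 'X_{1..n < N}) s : 'X_{1..n < N} :=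
  insubd m (mnm_act m s).

Lemma bmnm_actE N (m : 'X_{1..n < N}) s : bmnm_act m s = mnm_act m s :> 'X_{1..n}.
Proof. by rewrite insubdK // -topredE /= mdeg_mnm_act bmdeg. Qed.

(** The product with h_c adds up all the ways of lowering the exponent by [c] in total.
    The exponents that do not interlace cancel in pairs: if [i] is the first index with
    m_i at most k_(i+1), exchanging the entries [i] and [i+1] of [m] keeps [i] the first
    such index and changes the sign of the coefficient. *)
Lemma pieri N c q k : antisymmetric_poly q -> strict k -> (mdeg k < N)%N ->
  (hpoly c * q)@_k =
  \sum_(m : 'X_{1..n < N} | interlace m k && (mdeg m + c == mdeg k)%N) q@_m.
Proof.
move=> hq hk kN; rewrite (mcoeff_hpolyM _ _ kN).
rewrite (bigID (fun m : 'X_{1..n < _} => interlace m k)) /=.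
rewrite [X in _ + X](_ : _ = 0) ?addr0.
  apply: eq_bigl => m; rewrite andbC; case: (boolP (interlace m k)) => //=.
  by case/interlaceP => /mnm_lepP ->.
(* [bad m i] negates the interlacing condition at i; [flip] is the sign reversing involution. *)
pose bad (m : 'X_{1..n}) (i : 'I_n) := [exists j : 'I_n, (i < j)%N && (m i <= k j)%N].
pose first (m : 'X_{1..n}) (i : 'I_n) :=
  bad m i && [forall j : 'I_n, (j < i)%N ==> ~~ bad m j].
pose next (i : 'I_n) : 'I_n := insubd i i.+1.
pose flip (m : 'X_{1..n < N}) :=
  if [pick i | first m i] is Some i then bmnm_act m (tperm i (next i)) else m.
have first_uniq (m : 'X_{1..n}) i i' : first m i -> first m i' -> i = i'.
  move=> /andP[b1 /forallP f1] /andP[b2 /forallP f2]; apply: val_inj.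
  case: (ltngtP i i') => // h.
    by have /implyP/(_ h) := f2 i; rewrite b1.
  by have /implyP/(_ h) := f1 i'; rewrite b2.
apply: (@sum_sign_reversing _ _ _ flip) => m /andP[/andP[/mnm_lepP mk md] ni].
have [i hi] : exists i, first m i.
  have [i0 hi0] : exists i, bad m i.
    case/forallPn: ni => i; rewrite mk /= => /forallPn[j].
    rewrite negb_imply -leqNgt => h; exists i; by apply/existsP; exists j.
  case: (arg_minnP (fun i : 'I_n => i : nat) hi0) => i bi mi; exists i.
  rewrite /first bi; apply/forallP=> j; apply/implyP=> ji.
  by apply/negP=> /mi; rewrite leqNgt ji.
case/andP: (hi) => bi /forallP mini.
have /existsP[j0 /andP[ij0 hj0]] := bi.
have hn : next i = i.+1 :> nat.
  by rewrite /next val_insubd (leq_ltn_trans ij0 (ltn_ord j0)).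
have hine : i != next i by rewrite -val_eqE /= hn neq_ltn ltnSn.
have knext : (m i <= k (next i))%N.
  apply: leq_trans hj0 _; case: (ltngtP (next i) j0) => [/hk/ltnW //|h|/val_inj -> //].
  by move: h; rewrite hn ltnS leqNgt ij0.
have ef : flip m = bmnm_act m (tperm i (next i)).
  by rewrite /flip; case: pickP => [i' /(first_uniq _ _ _ hi) <- //|/(_ i)]; rewrite hi.
set m' := bmnm_act _ _ in ef.
have m'E : m' = mnm_act m (tperm i (next i)) :> 'X_{1..n} by rewrite bmnm_actE.
have fm' : first m' i.
  apply/andP; split.
    apply/existsP; exists (next i); rewrite hn ltnSn m'E mnm_actE tpermL /=; exact: mk.
  apply/forallP=> j; apply/implyP=> ji; have /implyP/(_ ji) := mini j.
  apply: contra => /existsP[j' /andP[jj' h]]; apply/existsP; exists j'; rewrite jj' /=.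
  move: h; rewrite m'E mnm_actE tpermD // -val_eqE /=; apply/eqP; first by lia.
  by rewrite hn; lia.
have ef' : flip m' = bmnm_act m' (tperm i (next i)).
  rewrite /flip; case: pickP => [i' /(first_uniq _ _ _ fm') <- //|/(_ i)]; by rewrite fm'.
rewrite ef; split.
- rewrite m'E mdeg_mnm_act md andbT; apply/andP; split.
    apply/mnm_lepP=> j; rewrite mnm_actE; case: tpermP => [->|->|_ _] //.
    apply: leq_trans (mk _) _; apply: ltnW; apply: hk; by rewrite hn.
  apply/negP => /interlaceP[_ h].
  have := h i (next i); rewrite hn ltnSn mnm_actE tpermL => /(_ isT).
  by rewrite ltnNge mk.
- rewrite ef'; apply: val_inj; rewrite /= bmnm_actE m'E.
  by rewrite -mnm_actM tperm2 mnm_act1.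
- by rewrite m'E antisym_coeff // odd_tperm hine expr1 mulN1r.
Qed.

(** Below [k], [q] behaves like the single Schur alternant with exponent [m0], so that only
    one term of Pieri's rule survives. *)
Lemma pieri_pure c q k m0 : antisymmetric_poly q -> strict k ->
  (forall m, strict m -> (m <= k)%MM -> q@_m = (m == m0)%:R) ->
  (hpoly c * q)@_k = (interlace m0 k && (mdeg m0 + c == mdeg k)%N)%:R.
Proof.
move=> hq hk hm; rewrite (@pieri (mdeg k + mdeg m0).+1 _ _ _ hq hk); last by rewrite ltnS leq_addr.
have m0N : (mdeg m0 < (mdeg k + mdeg m0).+1)%N by rewrite ltnS leq_addl.
have {}hm (m : 'X_{1..n}) : interlace m k -> q@_m = (m == m0)%:R.
  move=> im; apply: hm; first exact: interlace_strict im.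
  by apply/mnm_lepP; case/interlaceP: im.
rewrite (eq_bigr (fun m : 'X_{1..n < _} => (m == BMultinom m0N)%:R)); last first.
  by move=> m /andP[/hm -> _]; rewrite -val_eqE.
rewrite big_mkcond (bigD1 (BMultinom m0N)) //= eqxx big1 ?addr0; last first.
  by move=> m /negbTE ->; case: ifP.
by case: ifP.
Qed.

Lemma strict_rho : strict rho.
Proof. by move=> i j ij; rewrite !rhoE; have := ltn_ord j; lia. Qed.

(** Both exponents are decreasing, so [w] is an increasing permutation. *)
Lemma strict_act_id k w : strict k -> strict (mnm_act k w) -> w = 1%g.
Proof.
move=> hk hkw.
have mono (i j : 'I_n) : (i < j)%N = (w i < w j)%N.
  have h (a b : 'I_n) : (a < b)%N -> (w a < w b)%N.
    move=> ab; have := hkw _ _ ab; rewrite !mnm_actE => h.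
    case: (ltngtP (w a) (w b)) => // [/hk|/val_inj e]; first by lia.
    by move: h; rewrite e ltnn.
  case: (ltngtP i j) => [/h -> //|/h|/val_inj ->]; last by rewrite ltnn.
  by move=> ji; symmetry; apply/negbTE; rewrite -leqNgt ltnW.
have ge (f : {perm 'I_n}) : (forall i j : 'I_n, (i < j)%N = (f i < f j)%N) ->
    forall i : 'I_n, (i <= f i)%N.
  move=> hf [i hi]; elim: i hi => // i IH hi /=.
  by apply: leq_ltn_trans (IH (ltnW hi)) _; rewrite -hf.
have monoV (i j : 'I_n) : (i < j)%N = (w^-1%g i < w^-1%g j)%N.
  by rewrite [RHS]mono !permKV.
apply/permP=> i; rewrite perm1; apply: val_inj; apply/eqP; rewrite eqn_leq ge // andbT.
by have := ge _ monoV (w i); rewrite permK.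
Qed.

Lemma mcoeff_alternant k : strict k -> alternant@_k = (k == rho)%:R.
Proof.
move=> hk; rewrite /alternant raddf_sum /= (bigD1 (1%g : 'S_n)) //= big1 ?addr0.
  by rewrite odd_perm1 expr0 scale1r mcoeff_sym mperm1 mcoeffX eq_sym.
move=> w wn1; rewrite mcoeffZ mcoeff_sym mcoeffX; case: eqP => [e|_]; last by rewrite mulr0.
case/eqP: wn1; apply: strict_act_id hk _; rewrite /mnm_act -e; exact: strict_rho.
Qed.

Definition hprod (s : seq nat) : {mpoly algC[n]} := \prod_(c <- s) hpoly c.

Lemma hprod_cons c (s : seq nat) : hprod (c :: s) = hpoly c * hprod s.
Proof. by rewrite /hprod big_cons. Qed.

Lemma hprod_sym (s : seq nat) : hprod s \is symmetric.
Proof. by rewrite /hprod; apply: rpred_prod => c _; apply: hpoly_sym. Qed.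

Lemma hprodM_antisym (s : seq nat) q : antisymmetric_poly q -> antisymmetric_poly (hprod s * q).
Proof. by move=> hq; apply: antisym_symM => //; apply: hprod_sym. Qed.

Lemma pieri_support c q k : antisymmetric_poly q -> strict k ->
  (hpoly c * q)@_k != 0 ->
  exists m, [/\ interlace m k, (mdeg m + c)%N = mdeg k & q@_m != 0].
Proof.
move=> hq hk; rewrite (pieri c hq hk (ltnSn _)) => h.
have [m /andP[/andP[im /eqP dm] qm]] :
   exists m : 'X_{1..n < (mdeg k).+1},
     (interlace m k && (mdeg m + c == mdeg k)%N) && (q@_m != 0).
  apply/existsP; apply: contraR h => /existsPn h; apply/eqP; apply: big1 => m Pm.
  by have := h m; rewrite Pm /= negbK => /eqP.
by exists m.
Qed.

Lemma hprod_support (s : seq nat) q k : antisymmetric_poly q -> strict k ->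
  (hprod s * q)@_k != 0 ->
  exists m, [/\ strict m, (m <= k)%MM, (mdeg m + sumn s)%N = mdeg k & q@_m != 0].
Proof.
move=> hq; elim: s k => [|c s IH] k hk.
  rewrite /hprod big_nil mul1r => h; exists k; split=> //=; [exact: lepm_refl | by rewrite addn0].
rewrite hprod_cons -mulrA => /(pieri_support (hprodM_antisym s hq) hk) [m [im dm]].
case/(IH _ (interlace_strict im)) => m' [sm' lm' dm' qm']; exists m'; split=> //.
  apply/mnm_lepP=> i; apply: leq_trans (mnm_lepP lm' i) _.
  by case/interlaceP: im.
by rewrite /= -dm -dm' addnAC addnA.
Qed.

(** Each factor h_c adds a horizontal strip, hence at most one new row. *)
Lemma hprod_alternant_rows (s : seq nat) k : strict k -> (hprod s * alternant)@_k != 0 ->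
  (forall i : 'I_n, rho i <= k i)%N /\
  (forall i : 'I_n, (size s <= i)%N -> k i = rho i).
Proof.
elim: s k => [|c s IH] k hk.
  rewrite /hprod big_nil mul1r mcoeff_alternant //.
  by case: (k =P rho) => [-> _ |_]; [split | rewrite eqxx].
rewrite hprod_cons -mulrA.
case/(pieri_support (hprodM_antisym s alternant_antisym) hk) => m [im _].
case/(IH _ (interlace_strict im)) => h1 h2.
case/interlaceP: im => mk km; split=> [i|[[|i] hi] //= si].
  exact: leq_trans (h1 i) (mk i).
apply/eqP; rewrite eqn_leq (leq_trans (h1 _) (mk _)) andbT.
have := km (Ordinal (ltnW hi)) (Ordinal hi) (ltnSn i); rewrite h2 // !rhoE /=.
by lia.
Qed.

(** The factors in [s2] are multiplied in first: they fill a shape with at most [size s2]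
    rows contained in the final shape, which bounds their total size. *)
Lemma kostka_dominance (s1 s2 : seq nat) k : strict k ->
  (hprod s1 * (hprod s2 * alternant))@_k != 0 ->
  (sumn s2 <= \sum_(i < n | (i < size s2)%N) (k i - rho i))%N.
Proof.
move=> hk /(hprod_support (hprodM_antisym s2 alternant_antisym) hk).
case=> m [sm /mnm_lepP lm _ qm].
have [h1 h2] := hprod_alternant_rows sm qm.
have [m' [sm' _ dm' ]] := hprod_support alternant_antisym sm qm.
rewrite mcoeff_alternant //; case: (m' =P rho) => [e _|_]; last by rewrite eqxx.
have -> : sumn s2 = (\sum_(i < n) (m i - rho i))%N.
  apply/eqP; rewrite -(eqn_add2l (mdeg rho)) -{1}e dm' !mdegE -big_split /=.
  by apply/eqP; apply: eq_bigr => i _; rewrite subnKC.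
rewrite (bigID (fun i : 'I_n => i < size s2)%N) /= [X in (_ + X)%N]big1 ?addn0.
  by apply: leq_sum => i _; apply: leq_sub2r.
by move=> i; rewrite -leqNgt => /h2 ->; rewrite subnn.
Qed.

Lemma kostka_degree (s : seq nat) k : strict k -> (hprod s * alternant)@_k != 0 ->
  mdeg k = (mdeg rho + sumn s)%N.
Proof.
move=> hk /(hprod_support alternant_antisym hk) [m [sm _ dm]].
by rewrite mcoeff_alternant //; case: (m =P rho) => [<- //|_]; rewrite eqxx.
Qed.

End Alternants.

(** * Kostka numbers *)

Section Kostka.

Variable n : nat.
Implicit Types (k m : 'X_{1..n}).

(** Within the final shape, the first [r] strips can only fill the first [r] rows
    completely, so there is a unique chain of strips. *)
Lemma kostka_diag (L : 'X_{1..n}) :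
  (forall i j : 'I_n, (i <= j)%N -> (L j <= L i)%N) ->
  ((\prod_(i < n) hpoly n (L i)) * alternant n)@_(L + rho n) = 1.
Proof.
move=> hL.
pose P r : {mpoly algC[n]} := \prod_(i < n | (i < r)%N) hpoly n (L i).
pose Lr r := ([multinom (if i < r then L i else 0)%N | i < n] + rho n)%MM.
have LrE r i : Lr r i = ((if i < r then L i else 0) + rho n i)%N by rewrite mnmDE mnmE.
have Panti r : antisymmetric_poly (P r * alternant n).
  apply: antisym_symM; last exact: alternant_antisym.
  by apply: rpred_prod => c _; apply: hpoly_sym.
have main r : (r <= n)%N -> forall k, strict k -> (k <= L + rho n)%MM ->
    (P r * alternant n)@_k = (k == Lr r)%:R.
  elim: r => [|r IH] hr k hk /mnm_lepP kL.
    rewrite /P big_pred0 // mul1r mcoeff_alternant //; congr (_ == _)%:R.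
    by apply/mnmP=> i; rewrite LrE.
  have -> : P r.+1 = hpoly n (L (Ordinal hr)) * P r.
    rewrite /P (bigD1 (Ordinal hr)) //=; congr (_ * _); apply: eq_bigl => i.
    by rewrite -val_eqE /= ltnS ltn_neqAle andbC.
  have Lr_eq i : (i != Ordinal hr) -> Lr r.+1 i = Lr r i.
    rewrite -val_eqE !LrE /= => h; congr addn.
    by rewrite ltnS leq_eqVlt (negbTE h).
  have Lr_r : Lr r.+1 (Ordinal hr) = (Lr r (Ordinal hr) + L (Ordinal hr))%N.
    by rewrite !LrE /= ltnn ltnSn; lia.
  have dLr : mdeg (Lr r.+1) = (mdeg (Lr r) + L (Ordinal hr))%N.
    rewrite !mdegE (bigD1 (Ordinal hr)) //= [in RHS](bigD1 (Ordinal hr)) //= Lr_r.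
    by rewrite (eq_bigr (Lr r)) => [|i /Lr_eq //]; rewrite addnAC.
  rewrite -mulrA (pieri_pure (m0 := Lr r) _ (Panti r) hk); last first.
    move=> m sm /mnm_lepP mk; apply: IH (ltnW hr) _ sm _.
    by apply/mnm_lepP=> i; apply: leq_trans (mk i) (kL i).
  congr (nat_of_bool _)%:R; apply/andP/eqP => [[/interlaceP[h1 h2] /eqP dk]|->].
    have off i : i != Ordinal hr -> k i = Lr r i.
      move=> ine; apply/eqP; rewrite eqn_leq h1 andbT.
      case: (ltnP i r) => hi; first by have := kL i; rewrite LrE hi mnmDE.
      have hi' : (r < i)%N by move: ine; rewrite -val_eqE /=; lia.
      case: i ine hi hi' => [[|i] hi] //= ine hir hir'.
      have := h2 (Ordinal (ltnW hi)) (Ordinal hi) (ltnSn i); rewrite !LrE /= !rhoE /=.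
      by case: (ltnP i r) => ?; case: (ltnP i.+1 r) => ?; lia.
    apply/mnmP=> i; case: (eqVneq i (Ordinal hr)) => [->|ine]; last by rewrite off ?Lr_eq.
    move: dk; rewrite Lr_r !mdegE (bigD1 (Ordinal hr)) //= [in RHS](bigD1 (Ordinal hr)) //=.
    have -> : (\sum_(j | j != Ordinal hr) k j = \sum_(j | j != Ordinal hr) Lr r j)%N.
      by apply: eq_bigr => j /off.
    by rewrite addnAC => /addIn.
  split; last by rewrite dLr.
  apply/interlaceP; split=> [i|i j ij].
    by case: (eqVneq i (Ordinal hr)) => [->|/Lr_eq -> //]; rewrite Lr_r leq_addr.
  have hrho := strict_rho ij; have hl := hL i j (ltnW ij).
  by rewrite !LrE; case: (ltnP j r.+1) => hj; case: (ltnP i r) => hi; lia.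
have sL : strict (L + rho n)%MM.
  move=> i j ij; rewrite !mnmDE; have := strict_rho ij; have := hL i j (ltnW ij); lia.
have eP : \prod_(i < n) hpoly n (L i) = P n by rewrite /P; apply: eq_bigl => i; rewrite ltn_ord.
rewrite eP main ?lepm_refl //; case: eqP => // [[]].
by apply/mnmP=> i; rewrite LrE mnmDE ltn_ord.
Qed.

Variable B : finType.
Implicit Type g : B -> nat.

(** For [k] the sum of a partition and [rho], this is the number of semistandard tableaux
    of that shape with [g b] entries [b]; the definition makes it plain that the order of
    the alphabet is irrelevant. *)
Definition kostka g k : algC := ((\prod_b hpoly n (g b)) * alternant n)@_k.

Lemma hprod_image (P : pred B) g :
  \prod_(b | P b) hpoly n (g b) = hprod n [seq g b | b <- enum P].
Proof. by rewrite /hprod big_map big_enum. Qed.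

Lemma sumn_image (P : pred B) g : sumn [seq g b | b <- enum P] = (\sum_(b | P b) g b)%N.
Proof. by rewrite sumnE big_map big_enum. Qed.

Lemma kostka_neq0_degree g k : strict k -> kostka g k != 0 ->
  mdeg k = (mdeg (rho n) + \sum_b g b)%N.
Proof.
rewrite /kostka hprod_image => sk /(kostka_degree sk) ->; by rewrite sumn_image.
Qed.

(** In an order of the alphabet that starts with [P], the letters in [P] only occupy the
    first #|P| rows. *)
Lemma kostka_neq0_dominance g k (P : pred B) : strict k -> kostka g k != 0 ->
  (\sum_(b | P b) g b <= \sum_(i < n | (i < #|P|)%N) (k i - rho n i))%N.
Proof.
rewrite /kostka (bigID P) /= -mulrA mulrCA !hprod_image => sk /(kostka_dominance sk).
by rewrite sumn_image size_map -cardE.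
Qed.

End Kostka.

Section RowStability.

Variable n : nat.
Implicit Types (k m : 'X_{1..n.+1}) (s : seq nat).
Local Notation e0 := (U_(ord0 : 'I_n.+1))%MM.

(** The tableaux with a single letter have one row. *)
Lemma hpoly_alternant c k : strict k ->
  (hpoly n.+1 c * alternant n.+1)@_k = (k == rho n.+1 + e0 *+ c)%MM%:R.
Proof.
move=> sk; rewrite (pieri_pure c (m0 := rho n.+1) (@alternant_antisym _) sk); last first.
  by move=> m sm _; apply: mcoeff_alternant.
congr (nat_of_bool _)%:R; apply/andP/eqP => [[/interlaceP[h1 h2] /eqP dk]|->].
  have off i : i != ord0 -> k i = rho n.+1 i.
    case: i => [[|i] hi] //= _; apply/eqP; rewrite eqn_leq h1 andbT.
    have := h2 (Ordinal (ltnW hi)) (Ordinal hi) (ltnSn i); rewrite !rhoE /=; lia.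
  apply/mnmP=> i; rewrite mnmDE mulmnE mnm1E.
  case: (eqVneq i ord0) => [->|ine]; last first.
    by rewrite off // mul0n addn0.
  rewrite mul1n; move: dk; rewrite !mdegE (bigD1 ord0) //= [in RHS](bigD1 ord0) //=.
  have -> : (\sum_(j | j != ord0) k j = \sum_(j | j != ord0) rho n.+1 j)%N.
    by apply: eq_bigr => j /off.
  by rewrite addnAC => /addIn.
split; last by rewrite mdegD mdegMn mdeg1 mul1n.
apply/interlaceP; split=> [i|i j ij]; rewrite mnmDE ?leq_addr //.
rewrite mulmnE mnm1E; case: eqP => [e|_]; first by move: ij; rewrite -e.
by rewrite mul0n addn0; apply: strict_rho.
Qed.

(** The letters of the innermost strip all sit in the first row. *)
Lemma hprod_first_part s c k : strict k ->
  (hprod n.+1 s * (hpoly n.+1 c * alternant n.+1))@_k != 0 ->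
  (rho n.+1 ord0 + c <= k ord0)%N.
Proof.
move=> sk; case/hprod_support => // [|m [sm /mnm_lepP lm _]].
  by apply: antisym_symM (@alternant_antisym _); apply: hpoly_sym.
rewrite hpoly_alternant //; case: (m =P _) => [e _|_]; last by rewrite eqxx.
by apply: leq_trans (lm ord0); rewrite e mnmDE mulmnE mnm1E eqxx mul1n.
Qed.

(** One more letter in the innermost strip corresponds to shifting the first row of the
    whole chain of horizontal strips.  The interlacing conditions only change between the
    first two rows, where the hypothesis makes them hold before and after the shift: the
    first row starts with rho_0 + c, beyond the reach of the second one. *)
Lemma hprod_add_first s c k : strict k ->
  (forall i : 'I_n.+1, i != ord0 -> k i < rho n.+1 ord0 + c)%N ->
  (hprod n.+1 s * (hpoly n.+1 c.+1 * alternant n.+1))@_(k + e0) =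
  (hprod n.+1 s * (hpoly n.+1 c * alternant n.+1))@_k.
Proof.
have sk_up k' : strict k' -> strict (k' + e0)%MM.
  move=> sk i j ij; rewrite !mnmDE !mnm1E; have := sk _ _ ij.
  by case: (ord0 =P j) => [e|_]; [move: ij; rewrite -e | lia].
have anti c' : antisymmetric_poly (hpoly n.+1 c' * alternant n.+1).
  by apply: antisym_symM (@alternant_antisym _); apply: hpoly_sym.
elim: s k => [|c' s IH] k sk kc.
  rewrite /hprod big_nil !mul1r !hpoly_alternant //; last exact: sk_up.
  congr (nat_of_bool _)%:R; rewrite mulmSr addmA eqm_add2r //.
rewrite !hprod_cons -!mulrA.
set N := (mdeg k).+2.
have kN : (mdeg k < N)%N by rewrite /N.
have kN' : (mdeg (k + e0)%MM < N)%N by rewrite mdegD mdeg1 addn1.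
rewrite (pieri _ _ sk kN) ?(pieri _ _ (sk_up _ sk) kN'); try exact: hprodM_antisym.
(* The terms with a shorter first row vanish, by [hprod_first_part]; the others correspond to
   each other under the shift by e0. *)
rewrite (bigID (fun m : 'X_{1..n.+1 < N} => rho n.+1 ord0 + c < m ord0)%N) /=.
rewrite [X in _ + X]big1 ?addr0; last first.
  move=> m /andP[/andP[im _]]; apply: contraNeq => /hprod_first_part.
  by rewrite addnS => -> //; apply: interlace_strict im.
rewrite [RHS](bigID (fun m : 'X_{1..n.+1 < N} => rho n.+1 ord0 + c <= m ord0)%N) /=.
rewrite [X in _ = _ + X]big1 ?addr0; last first.
  move=> m /andP[/andP[im _]]; apply: contraNeq => /hprod_first_part.
  by move=> -> //; apply: interlace_strict im.
pose up (m : 'X_{1..n.+1 < N}) : 'X_{1..n.+1 < N} := insubd m (m + e0)%MM.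
pose down (m : 'X_{1..n.+1 < N}) : 'X_{1..n.+1 < N} := insubd m (m - e0)%MM.
have downE (m : 'X_{1..n.+1 < N}) : down m = (m - e0)%MM :> 'X_{1..n.+1}.
  rewrite insubdK // -topredE /=; apply: leq_ltn_trans (bmdeg m).
  by rewrite !mdegE; apply: leq_sum => i _; rewrite mnmBE leq_subr.
have upE (m : 'X_{1..n.+1 < N}) : (mdeg m < (mdeg k).+1)%N -> up m = (m + e0)%MM :> 'X_{1..n.+1}.
  by move=> h; rewrite insubdK // -topredE /= mdegD mdeg1 addn1.
have e0_le (m : 'X_{1..n.+1}) : (0 < m ord0)%N -> (e0 <= m)%MM.
  move=> h; apply/mnm_lepP=> i; rewrite mnm1E; by case: eqP => [<-|].
rewrite (reindex_onto up down) /=; last first.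
  move=> m /andP[/andP[im dm] m0]; apply: val_inj => /=.
  have me0 : (e0 <= m)%MM by apply: e0_le; lia.
  rewrite upE downE ?submK //.
  have := submK me0 => /(congr1 (@mdeg _)); rewrite mdegD mdeg1.
  have := bmdeg m; rewrite /N; lia.
have bnd (m : 'X_{1..n.+1}) : (mdeg m + c' == mdeg k)%N -> (mdeg m < (mdeg k).+1)%N.
  by move=> /eqP <-; rewrite ltnS leq_addr.
have key (m : 'X_{1..n.+1 < N}) : (mdeg m < (mdeg k).+1)%N ->
  [&& interlace (m + e0) (k + e0), mdeg (m + e0)%MM + c' == mdeg (k + e0)%MM
    & rho n.+1 ord0 + c < (m + e0)%MM ord0]%N =
  [&& interlace m k, mdeg m + c' == mdeg k & rho n.+1 ord0 + c <= m ord0]%N.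
  move=> mN; rewrite mnmDE mnm1E eqxx addn1 ltnS !mdegD mdeg1.
  rewrite addnAC eqn_add2r; case: (leqP _ (m ord0)) => m0; rewrite ?andbF ?andbT //.
  congr (_ && _); apply/interlaceP/interlaceP => [[h1 h2]|[h1 h2]]; split.
  - by move=> i; have := h1 i; rewrite !mnmDE leq_add2r.
  - move=> i j ij; have := h2 i j ij; rewrite !mnmDE !mnm1E.
    case: (ord0 =P j) => [e|/eqP ne]; first by move: ij; rewrite -e.
    case: (ord0 =P i) => [<-|_]; last by rewrite !addn0.
    move=> _; apply: leq_trans m0; apply: kc; by rewrite eq_sym.
  - by move=> i; rewrite !mnmDE leq_add2r.
  - move=> i j ij; have := h2 i j ij; rewrite !mnmDE !mnm1E.
    case: (ord0 =P j) => [e|_]; first by move: ij; rewrite -e.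
    lia.
apply: eq_big => [m|m].
  apply/andP/idP => [[/andP[/andP[h1 h2] h3] /eqP e]|/andP[/andP[h1 h2] h3]].
    have hm : (mdeg m < (mdeg k).+1)%N.
      have := congr1 (fun x : 'X_{1..n.+1 < N} => mdeg x) e; rewrite /= downE.
      have me0 : (e0 <= up m)%MM by apply: e0_le; lia.
      have := submK me0 => /(congr1 (@mdeg _)); rewrite mdegD mdeg1.
      have := bmdeg (up m); rewrite /N; lia.
    by have := key m hm; rewrite -(upE _ hm) h1 h2 h3 /= => /esym/and3P[-> -> ->].
  have hm := bnd _ h2; split; last first.
    by apply/eqP/val_inj; rewrite /= downE upE // addmK.
  by rewrite -andbA upE // key // h1 h2 h3.
move=> /andP[/andP[/andP[h1 h2] h3] /eqP e].
have hm : (mdeg m < (mdeg k).+1)%N.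
  have := congr1 (fun x : 'X_{1..n.+1 < N} => mdeg x) e; rewrite /= downE.
  have me0 : (e0 <= up m)%MM by apply: e0_le; lia.
  have := submK me0 => /(congr1 (@mdeg _)); rewrite mdegD mdeg1.
  have := bmdeg (up m); rewrite /N; lia.
have := key m hm; rewrite -(upE _ hm) h1 h2 h3 /= => /esym/and3P[im dm m0].
rewrite upE // IH //; first exact: interlace_strict im.
move=> i ine; apply: leq_ltn_trans (kc _ ine).
by case/interlaceP: im.
Qed.

Variable B : finType.
Implicit Type g : B -> nat.

(** Adding a letter [b0] to the first row of a tableau is a bijection when there are at
    least as many letters [b0] as boxes in the second row. *)
Lemma kostka_first_part_add g g' k b0 : strict k ->
  (forall i : 'I_n.+1, i != ord0 -> k i < rho n.+1 ord0 + g b0)%N ->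
  g' b0 = (g b0).+1 -> (forall b, b != b0 -> g' b = g b) ->
  kostka g' (k + e0)%MM = kostka g k.
Proof.
move=> sk kc g'0 g'g; rewrite /kostka (bigD1 b0) //= [in RHS](bigD1 b0) //= g'0.
rewrite (eq_bigr (fun b => hpoly n.+1 (g b))) => [|b /g'g -> //].
rewrite ![hpoly _ _ * _]mulrC -!mulrA hprod_image.
exact: hprod_add_first.
Qed.

End RowStability.

(** * Words, contents and permutation characters *)

Section Content.

Variables (m : nat) (B : finType).
Implicit Types (f : {ffun 'I_m -> B}) (g : B -> nat) (s t : 'S_m).

Definition has_content f g := [forall b, #|[pred x | f x == b]| == g b].

Definition fixed_by f s := [forall x, f (s x) == f x].

Definition fcomp f s : {ffun 'I_m -> B} := [ffun x => f (s x)].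

Lemma fcompE f s x : fcomp f s x = f (s x).
Proof. by rewrite ffunE. Qed.

Lemma fcompM f s t : fcomp (fcomp f t) s = fcomp f (s * t).
Proof. by apply/ffunP=> x; rewrite !fcompE permM. Qed.

Lemma fcomp1 f : fcomp f 1 = f.
Proof. by apply/ffunP=> x; rewrite fcompE perm1. Qed.

Lemma fcompK s : cancel (fcomp^~ s) (fcomp^~ s^-1%g).
Proof. by move=> f; rewrite fcompM mulVg fcomp1. Qed.

Lemma fixed_byE f s : fixed_by f s = (fcomp f s == f).
Proof.
apply/forallP/eqP => [h|h x]; first by apply/ffunP=> x; rewrite fcompE; apply/eqP.
by rewrite -{2}h fcompE.
Qed.

Lemma has_content_fcomp f g s : has_content (fcomp f s) g = has_content f g.
Proof.
apply: eq_forallb => b; congr (_ == _).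
rewrite -!sum1_card /= [RHS](reindex_inj (@perm_inj _ s)) /=.
by apply: eq_bigl => x; rewrite !inE fcompE.
Qed.

Lemma has_content_sum f g : has_content f g -> (\sum_b g b)%N = m.
Proof.
move=> /forallP h; rewrite -[RHS]card_ord -sum1_card (partition_big f xpredT) //=.
by apply: eq_bigr => b _; rewrite sum1_card (eqP (h b)).
Qed.

Lemma count_content f b : count_mem b [tuple f i | i < m] = #|[pred x | f x == b]|.
Proof.
rewrite /= -sum1_count big_map big_enum_cond -sum1_card /=.
by apply: eq_bigl => x; rewrite !inE.
Qed.

Lemma has_content_ex g : (\sum_b g b)%N = m -> exists f, has_content f g.
Proof.
move=> hg; pose r := flatten [seq nseq (g b) b | b <- enum B].
have sr : size r == m.
  rewrite size_flatten /shape -map_comp sumnE big_map -hg big_enum /=.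
  by apply/eqP; apply: eq_bigr => b _; rewrite size_nseq.
exists [ffun i => tnth (Tuple sr) i]; apply/forallP=> b; apply/eqP.
rewrite -count_content (_ : [tuple _ | _ < _] = Tuple sr); last first.
  by apply: eq_from_tnth => i; rewrite tnth_mktuple ffunE.
rewrite /= count_flatten -map_comp sumnE big_map big_enum /= (bigD1 b) //= big1 ?addn0.
  by rewrite count_nseq /= eqxx mul1n.
by move=> b' /negbTE h; rewrite count_nseq /= h.
Qed.

Lemma has_content_conj f f' g : has_content f g -> has_content f' g ->
  exists s, f' = fcomp f s.
Proof.
move=> /forallP h /forallP h'.
have /tuple_permP [s e] : perm_eq [tuple f' i | i < m] [tuple f i | i < m].
  apply/allP=> b _; rewrite /=; apply/eqP.
  rewrite [LHS](count_content f' b) [RHS](count_content f b).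
  by rewrite (eqP (h b)) (eqP (h' b)).
exists s; apply/ffunP=> x; rewrite fcompE.
have e' : [tuple f' i | i < m] = [tuple tnth [tuple f i | i < m] (s i) | i < m].
  exact: val_inj.
by have := congr1 (@tnth _ _ ^~ x) e'; rewrite !tnth_mktuple.
Qed.

(** Burnside's count for a transitive action: the stabilizer of each word of the orbit has
    as many elements as there are permutations that lead to it from a fixed one. *)
Lemma sum_stabilizers g : (\sum_b g b)%N = m ->
  (\sum_(f | has_content f g) #|[pred s | fixed_by f s]|)%N = m`!.
Proof.
move=> hg; have [f0 h0] := has_content_ex hg.
rewrite -card_Sn -cardsT -[RHS]sum1_card (partition_big (fcomp f0) (has_content^~ g)) /=.
  apply: eq_bigr => f hf; have [t et] := has_content_conj h0 hf.
  rewrite -sum1_card [RHS](reindex_inj (mulIg t)) /=; apply: eq_bigl => s.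
  by rewrite !inE fixed_byE {1}et fcompM.
by move=> s _; rewrite has_content_fcomp.
Qed.

(** If a letter is repeated, the transposition of two of its occurrences cancels the
    stabilizer in pairs; otherwise the stabilizers are trivial. *)
Lemma sum_signed_stabilizers g : (\sum_b g b)%N = m ->
  \sum_(f | has_content f g) \sum_(s | fixed_by f s) (-1) ^+ s =
  (if [forall b, g b <= 1]%N then (m`!)%:R else 0) :> algC.
Proof.
move=> hg; case: ifP => [/forallP g1|/negbT /forallPn [b hb]].
  rewrite -(sum_stabilizers hg) natr_sum; apply: eq_bigr => f /forallP hf.
  have fixE s : fixed_by f s = (s == 1%g).
    apply/forallP/eqP => [h|-> x]; last by rewrite perm1.
    apply/permP=> x; rewrite perm1.
    have : (#|[pred y | f y == f x]| <= 1)%N by rewrite (eqP (hf _)).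
    by move/card_le1_eqP; apply; rewrite inE //= (eqP (h x)).
  by rewrite (big_pred1 1%g) // (eq_card1 (x := 1%g)) // odd_perm1.
apply: big1 => f /forallP hf.
have : (1 < #|[pred x | f x == b]|)%N by rewrite (eqP (hf b)) ltnNge.
case/card_gt1P => x [y [hx hy xy]].
apply: (@sum_sign_reversing _ _ _ (fun s => tperm x y * s)%g) => s; rewrite !fixed_byE => /eqP fs.
split; last by rewrite odd_permM odd_tperm xy signr_addb expr1 mulN1r.
  rewrite -fcompM fs; apply/eqP/ffunP=> z; rewrite fcompE.
  by case: tpermP => // ->; rewrite !inE in hx hy; rewrite (eqP hx) (eqP hy).
by rewrite mulgA tperm2 mul1g.
Qed.

Definition fix_count g s := #|[pred f | has_content f g && fixed_by f s]|.

Fact permc_subproof g : is_class_fun <<[set: 'S_m]>>%g [ffun s => (fix_count g s)%:R].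
Proof.
apply: intro_class_fun => [s t _ _|s]; last by rewrite mem_gen ?inE.
congr (_%:R); rewrite /fix_count -!sum1_card /=.
rewrite [RHS](reindex_inj (can_inj (fcompK t))) /=; apply: eq_bigl => f.
rewrite !inE has_content_fcomp !fixed_byE; congr (_ && _).
rewrite -(inj_eq (can_inj (fcompK t))) !fcompM conjgE !mulgA mulgV mul1g.
by [].
Qed.

(** The permutation character on the words with content [g]: the character induced from
    the trivial one of a Young subgroup when the sum of [g] is [m], and 0 otherwise. *)
Definition permc g : 'CF([set: 'S_m]) := Cfun 1 (permc_subproof g).

Lemma permcE g s : permc g s = (fix_count g s)%:R.
Proof. by rewrite cfunElock. Qed.

Fact sgnc_subproof : is_class_fun <<[set: 'S_m]>>%g [ffun s : 'S_m => (-1) ^+ s].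
Proof.
apply: intro_class_fun => [s t _ _|s]; last by rewrite mem_gen ?inE.
by rewrite odd_permJ.
Qed.

Definition sgnc : 'CF([set: 'S_m]) := Cfun 1 sgnc_subproof.

Lemma sgncE s : sgnc s = (-1) ^+ s.
Proof. by rewrite cfunElock. Qed.

Lemma permc_conj g s : (permc g s)^* = permc g s.
Proof. by rewrite permcE conjC_nat. Qed.

Lemma sgnc_conj s : (sgnc s)^* = sgnc s.
Proof. by rewrite sgncE rmorphXn rmorphN1. Qed.

Lemma permc_eq0 g : (\sum_b g b)%N != m -> permc g = 0.
Proof.
move=> hg; apply/cfunP=> s; rewrite permcE cfunE /fix_count eq_card0 // => f.
by rewrite !inE; apply: contraNF hg => /andP[/has_content_sum ->].
Qed.

Lemma permc_sum (theta : 'S_m -> algC) g :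
  \sum_s permc g s * theta s =
  \sum_(f | has_content f g) \sum_(s | fixed_by f s) theta s.
Proof.
rewrite (exchange_big_dep xpredT) //=; apply: eq_bigr => s _.
rewrite permcE /fix_count -sum1_card natr_sum mulr_suml.
by apply: eq_big => [f|f _]; rewrite ?inE ?mul1r.
Qed.

Lemma cfdot_permc_cfun1 g : '[permc g, 1] = ((\sum_b g b)%N == m)%:R.
Proof.
case: eqP => [hg|/eqP/permc_eq0 ->]; last by rewrite cfdot0l.
rewrite cfdotE cardsT card_Sn.
under eq_bigr do rewrite cfun1E inE conjC1.
rewrite (eq_bigl xpredT) ?permc_sum => [|s]; last by rewrite inE.
under eq_bigr do rewrite sumr_const.
by rewrite -natr_sum sum_stabilizers // mulVf // pnatr_eq0 -lt0n fact_gt0.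
Qed.

Lemma cfdot_permc_sgnc g :
  '[permc g, sgnc] = ([forall b, g b <= 1]%N && ((\sum_b g b)%N == m))%:R.
Proof.
case: (_ =P m) => [hg|/eqP/permc_eq0 ->]; last by rewrite cfdot0l andbF.
rewrite cfdotE cardsT card_Sn andbT.
under eq_bigr do rewrite sgnc_conj sgncE.
rewrite (eq_bigl xpredT) ?permc_sum => [|s]; last by rewrite inE.
rewrite sum_signed_stabilizers //; case: ifP => _; last by rewrite mulr0.
by rewrite mulVf // pnatr_eq0 -lt0n fact_gt0.
Qed.

End Content.

(** * Inner products of permutation characters and matrices *)

Section Tensor.

Variables (m : nat) (A B : finType).
Implicit Types (c : A -> nat) (e : B -> nat).
Local Notation matrix := {ffun A * B -> 'I_m.+1}.
Implicit Type M : matrix.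

Definition margins c e M :=
  [forall a, \sum_b M (a, b) == c a]%N && [forall b, \sum_a M (a, b) == e b]%N.

Lemma card_fiber_fst (f : 'I_m -> A * B) a :
  #|[pred x | (f x).1 == a]| = (\sum_b #|[pred x | f x == (a, b)]|)%N.
Proof.
rewrite -sum1_card (partition_big (fun x => (f x).2) xpredT) //=; apply: eq_bigr => b _.
by rewrite -sum1_card; apply: eq_bigl => x; rewrite !inE; case: (f x).
Qed.

Lemma card_fiber_snd (f : 'I_m -> A * B) b :
  #|[pred x | (f x).2 == b]| = (\sum_a #|[pred x | f x == (a, b)]|)%N.
Proof.
rewrite -sum1_card (partition_big (fun x => (f x).1) xpredT) //=; apply: eq_bigr => a _.
by rewrite -sum1_card; apply: eq_bigl => x; rewrite !inE; case: (f x) => u v; rewrite andbC.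
Qed.

(** A pair of words is a word of pairs, whose content is a matrix with the two contents as
    margins. *)
Lemma permcM c e :
  permc m c * permc m e = \sum_(M : matrix | margins c e M) permc m (fun p => M p).
Proof.
apply/cfunP=> s; rewrite cfunE !permcE sum_cfunE.
under eq_bigr do rewrite permcE.
rewrite -natrM -natr_sum; congr (_%:R).
pose pair2 (u : {ffun 'I_m -> A} * {ffun 'I_m -> B}) : {ffun 'I_m -> A * B} :=
  [ffun x => (u.1 x, u.2 x)].
pose split2 (f : {ffun 'I_m -> A * B}) : {ffun 'I_m -> A} * {ffun 'I_m -> B} :=
  ([ffun x => (f x).1], [ffun x => (f x).2]).
have pairK : cancel pair2 split2.
  by case=> u v; rewrite /split2; congr pair; apply/ffunP=> x; rewrite !ffunE.
have splitK : cancel split2 pair2.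
  by move=> f; apply/ffunP=> x; rewrite !ffunE /=; case: (f x).
pose cont (f : {ffun 'I_m -> A * B}) : matrix :=
  [ffun p => inord #|[pred x | f x == p]|].
have contE f p : cont f p = #|[pred x | f x == p]| :> nat.
  by rewrite ffunE inordK // ltnS -[m in (_ <= m)%N]card_ord max_card.
rewrite /fix_count -cardX -sum1_card (reindex split2) /=; last first.
  by exists pair2 => ? _; [apply: splitK | apply: pairK].
have contP f : margins c e (cont f) =
    has_content (split2 f).1 c && has_content (split2 f).2 e.
  congr (_ && _); apply: eq_forallb => z; congr (_ == _); under eq_bigr do rewrite contE.
    by rewrite -card_fiber_fst; apply: eq_card => x; rewrite !inE ffunE.
  by rewrite -card_fiber_snd; apply: eq_card => x; rewrite !inE ffunE.
rewrite (partition_big cont (margins c e)) /=; last first.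
  by move=> f; rewrite !inE /= contP => /andP[/andP[-> _] /andP[-> _]].
apply: eq_bigr => M hM; rewrite -sum1_card; apply: eq_bigl => f; rewrite !inE /=.
have fixP : fixed_by f s = fixed_by (split2 f).1 s && fixed_by (split2 f).2 s.
  apply/forallP/andP => [h|[/forallP h1 /forallP h2] x].
    by split; apply/forallP => x; rewrite !ffunE (eqP (h x)).
  have := h1 x; have := h2 x; rewrite !ffunE; case: (f _) (f _) => ? ? [? ?] /=.
  by move=> /eqP -> /eqP ->.
have contM : has_content f (fun p => M p) = (cont f == M).
  apply/forallP/eqP => [h|<- p]; last by rewrite contE.
  by apply/ffunP=> p; apply: val_inj; rewrite /= contE (eqP (h p)).
rewrite contM fixP; case: eqP => [e1|_]; rewrite ?andbT ?andbF //.
by move: (contP f); rewrite e1 hM => /esym/andP[-> ->].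
Qed.

Lemma margins_sum c e M : margins c e M -> (\sum_p M p)%N = (\sum_a c a)%N.
Proof.
case/andP=> /forallP h _; rewrite -(eq_bigr _ (fun a _ => eqP (h a))) pair_bigA /=.
by apply: eq_bigr => -[].
Qed.

Lemma cfdot_permc c e : (\sum_a c a)%N = m ->
  '[permc m c, permc m e] = #|margins c e|%:R.
Proof.
move=> hc.
have -> : '[permc m c, permc m e] = '[permc m c * permc m e, 1].
  rewrite !cfdotE; congr (_ * _); apply: eq_bigr => s sS.
  by rewrite cfunE permc_conj cfun1E sS conjC1 mulr1.
rewrite permcM cfdot_suml -sum1_card natr_sum; apply: eq_big => // M hM.
by rewrite cfdot_permc_cfun1 (margins_sum hM) hc eqxx.
Qed.

Lemma cfdot_permc_sgn c e : (\sum_a c a)%N = m ->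
  '[permc m c, sgnc m * permc m e] =
  #|[pred M | margins c e M && [forall p, (M p <= 1)%N]]|%:R.
Proof.
move=> hc.
have -> : '[permc m c, sgnc m * permc m e] = '[permc m c * permc m e, sgnc m].
  rewrite !cfdotE; congr (_ * _); apply: eq_bigr => s sS.
  by rewrite !cfunE rmorphM /= permc_conj mulrCA mulrC.
rewrite permcM cfdot_suml -sum1_card natr_sum /=.
under [RHS]eq_bigl do rewrite inE.
rewrite [RHS]big_mkcondr /=; apply: eq_bigr => M hM.
by rewrite cfdot_permc_sgnc (margins_sum hM) hc eqxx andbT; case: ifP.
Qed.

End Tensor.

Section Frobenius.

Variable n : nat.

Lemma hpoly_ffun D c : (c < D)%N ->
  hpoly n c = \sum_(v : {ffun 'I_n -> 'I_D} | (\sum_i v i == c)%N) 'X_[[multinom (v i : nat) | i < n]].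
Proof.
move=> cD; apply/mpolyP=> k; rewrite mcoeff_hpoly raddf_sum /=.
under eq_bigr do rewrite mcoeffX.
case: eqP => [e|ne]; last first.
  rewrite big1 // => v /eqP hv; case: eqP => // e; case: ne; rewrite -hv -e mdegE.
  by apply: eq_bigr => i _; rewrite mnmE.
have kD i : (k i < D)%N.
  by apply: leq_ltn_trans cD; rewrite -e mdegE (bigD1 i) //= leq_addr.
pose v0 : {ffun 'I_n -> 'I_D} := [ffun i => Ordinal (kD i)].
rewrite (bigD1 v0) /=; last first.
  by rewrite -e mdegE; apply/eqP; apply: eq_bigr => i _; rewrite ffunE.
rewrite (_ : [multinom _ | _ < _] = k) ?eqxx ?big1 ?addr0 //; last first.
  by apply/mnmP=> i; rewrite mnmE ffunE.
move=> v /andP[_ ne]; case: eqP => // e1; case/eqP: ne.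
by apply/ffunP=> i; apply: val_inj; rewrite ffunE /= -e1 mnmE.
Qed.

Variables (m : nat) (B : finType).

(** Expanding a product of complete symmetric polynomials, each monomial is obtained from
    the matrices whose columns record the monomials chosen in the factors. *)
Lemma mcoeff_prod_hpoly (c : 'X_{1..n}) (g : B -> nat) :
  mdeg c = m -> (\sum_b g b)%N = m ->
  (\prod_b hpoly n (g b))@_c = '[permc m c, permc m g].
Proof.
move=> hc hg; rewrite cfdot_permc; last by rewrite -mdegE.
rewrite (eq_bigr (fun b => \sum_(v : {ffun 'I_n -> 'I_m.+1} | (\sum_i v i == g b)%N)
            'X_[[multinom (v i : nat) | i < n]])); last first.
  by move=> b _; apply: hpoly_ffun; rewrite -hg (bigD1 b) //= ltnS leq_addr.
rewrite bigA_distr_big_dep raddf_sum /=.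
pose tr (F : {ffun B -> {ffun 'I_n -> 'I_m.+1}}) : {ffun 'I_n * B -> 'I_m.+1} :=
  [ffun p => F p.2 p.1].
pose tr' (M : {ffun 'I_n * B -> 'I_m.+1}) : {ffun B -> {ffun 'I_n -> 'I_m.+1}} :=
  [ffun b => [ffun i => M (i, b)]].
rewrite -sum1_card natr_sum (reindex tr) /=; last first.
  exists tr' => [F _|M _]; first by apply/ffunP=> b; apply/ffunP=> i; rewrite !ffunE.
  by apply/ffunP=> -[i b]; rewrite !ffunE.
rewrite [RHS]big_mkcond [LHS]big_mkcond; apply: eq_bigr => F _.
rewrite mprodXE mcoeffX; set mF := (\sum_(b : B) _)%MM.
have mFE i : mF i = (\sum_b F b i)%N.
  by rewrite /mF mnm_sumE; apply: eq_bigr => b _; rewrite mnmE.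
have -> : (tr F \in margins c g) = (F \in family (fun b (v : {ffun 'I_n -> 'I_m.+1}) => (\sum_i v i)%N == g b)) && (mF == c).
  rewrite andbC /margins unfold_in; congr (_ && _).
    apply/forallP/eqP => [h|<- i].
      by apply/mnmP=> i; rewrite mFE -(eqP (h i)); apply: eq_bigr => b _; rewrite ffunE.
    by rewrite mFE; apply/eqP; apply: eq_bigr => b _; rewrite ffunE.
  by apply: eq_forallb => b; congr (_ == _); apply: eq_bigr => i _; rewrite ffunE.
by case: (F \in _) => //=; case: eqP.
Qed.

End Frobenius.

Lemma card_ord_lt n r : (r <= n)%N -> #|[pred j : 'I_n | (j < r)%N]| = r.
Proof. by move=> rn; rewrite -sum1_card /= (big_ord_narrow rn) sum1_card card_ord. Qed.

(** * The determinantal formula *)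

Section FrobeniusCharacter.

Variables (n m : nat).
Implicit Types (k L : 'X_{1..n}) (w : 'S_n).

Lemma mcoeffMX_sub (p : {mpoly algC[n]}) r k :
  (p * 'X_[r])@_k = if (r <= k)%MM then p@_(k - r) else 0.
Proof.
case: ifP => [rk|/negP nrk]; first by rewrite -{1}(submK rk) addmC mcoeffMX.
rewrite mcoeffM big1 // => ab /eqP e; rewrite mcoeffX.
case: eqP => [er|_]; last by rewrite mulr0.
case: nrk; rewrite er; apply/mnm_lepP=> i.
by move/mnmP/(_ i): e => ->; rewrite mnmDE leq_addl.
Qed.

(** The determinant in the Jacobi-Trudi formula, expanded, with each product of complete
    symmetric functions replaced by the permutation character that it is the
    characteristic of.  The index [k] is a partition plus [rho]; the terms with a negative
    row length are omitted. *)
Definition frob k : 'CF([set: 'S_m]) :=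
  \sum_(w : 'S_n | (rho n <= mnm_act k w)%MM)
    (-1) ^+ w *: permc m (fun i => (mnm_act k w - rho n)%MM i).

Lemma cfdot_frob (B : finType) (g : B -> nat) k : strict k ->
  mdeg k = (mdeg (rho n) + m)%N -> '[frob k, permc m g] = kostka g k.
Proof.
move=> sk dk; case: (eqVneq (\sum_b g b)%N m) => [hg|ng]; last first.
  rewrite (permc_eq0 ng) cfdot0r; apply/eqP; rewrite eq_sym.
  apply: contraNT ng => /(kostka_neq0_degree sk); rewrite dk => /addnI ->.
  by rewrite eqxx.
rewrite /frob cfdot_suml /kostka /alternant mulr_sumr raddf_sum /=.
rewrite big_mkcond; apply: eq_bigr => w _.
have hs : \prod_b hpoly n (g b) \is symmetric.
  by apply: rpred_prod => b _; apply: hpoly_sym.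
rewrite -scalerAr mcoeffZ -{1}(issymP _ hs w) -msymM mcoeff_sym mcoeffMX_sub.
case: ifP => rk; last by rewrite mulr0.
rewrite cfdotZl; congr (_ * _); rewrite -mcoeff_prod_hpoly //.
by apply/eqP; rewrite -(eqn_add2l (mdeg (rho n))) -dk addnC -mdegD submK // mdeg_mnm_act.
Qed.

Lemma frob_conj k s : (frob k s)^* = frob k s.
Proof.
rewrite /frob sum_cfunE rmorph_sum; apply: eq_bigr => w _ /=.
by rewrite cfunE rmorphM /= permc_conj rmorphXn rmorphN1.
Qed.

(** For w different from 1, w (L + rho) - rho is not dominated by L.  If [i] is the first
    index moved by [w], the first [i] entries together with the entry that receives L_i
    add up to more than the first [i+1] entries of [L]. *)
Lemma dominated_act_id L w :
  (forall P : pred 'I_n, (\sum_(i | P i) (mnm_act (L + rho n)%MM w - rho n)%MM i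
                    <= \sum_(i < n | i < #|P|) L i)%N) ->
  w = 1%g.
Proof.
move=> hP; apply/permP=> i; rewrite perm1.
have [N] := ubnP (i : nat); elim: N i => // N IH i /ltnSE hi.
have fixlt (j : 'I_n) : (j < i)%N -> w j = j by move=> ji; apply: IH; apply: leq_trans ji hi.
set i' := w^-1%g i; have wi' : w i' = i by rewrite permKV.
case: (ltngtP i' i) => [h|h|/val_inj e]; last by rewrite -{1}e wi'.
  by have := fixlt _ h; rewrite wi' => e; rewrite -e ltnn in h.
(* These entries are L_0, ..., L_(i-1) and L_i + rho_i - rho_(i'). *)
pose P := [pred j : 'I_n | (j == i') || (j < i)%N].
have cP : #|P| = i.+1.
  rewrite (cardD1 i') inE eqxx /= add1n -[in RHS](card_ord_lt (ltnW (ltn_ord i))).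
  congr S; apply: eq_card => j; rewrite !inE.
  by case: (eqVneq j i') => [->|] //=; rewrite ltnNge ltnW.
have := hP P; rewrite cP (bigD1 i') /= ?eqxx // [X in (_ <= X)%N -> _](bigD1 i) //=.
rewrite [X in (_ + X <= _)%N](_ : _ = \sum_(j < n | (j < i)%N) L j)%N; last first.
  apply: eq_big => [j|j /andP[/orP[->//|ji] _]].
    case: (eqVneq j i') => [->|] /=; rewrite ?andbF ?andbT //.
    by rewrite ltnNge ltnW.
  by rewrite mnmBE mnm_actE fixlt // mnmDE addnK.
rewrite [X in (_ <= _ + X)%N](_ : _ = \sum_(j < n | (j < i)%N) L j)%N; last first.
  by apply: eq_bigl => j; rewrite ltnS ltn_neqAle andbC.
rewrite leq_add2r mnmBE mnm_actE wi' mnmDE !rhoE; have := ltn_ord i'; lia.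
Qed.

Variable L : 'X_{1..n}.
Hypothesis L_decr : forall i j : 'I_n, (i <= j)%N -> (L j <= L i)%N.
Hypothesis L_deg : mdeg L = m.

Lemma strict_addrho : strict (L + rho n)%MM.
Proof.
move=> i j ij; rewrite !mnmDE; have := strict_rho ij; have := L_decr (ltnW ij); lia.
Qed.

Lemma cfdot_frob_self :
  '[frob (L + rho n)%MM, permc m (fun i => L i)] = 1.
Proof.
rewrite cfdot_frob ?mdegD ?L_deg 1?addnC //; first exact: kostka_diag.
exact: strict_addrho.
Qed.

(** By dominance, only the term of the identity has a non-zero inner product with [frob]. *)
Lemma frob_norm : '[frob (L + rho n)%MM] = 1.
Proof.
rewrite {2}/frob cfdot_sumr (bigD1 1%g) /=; last first.
  by rewrite mnm_act1; apply: lem_addl.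
rewrite mnm_act1 addmK odd_perm1 expr0 scale1r cfdot_frob_self big1 ?addr0 //.
move=> w /andP[_ wn1]; rewrite cfdotZr.
rewrite cfdot_frob; [|exact: strict_addrho|by rewrite mdegD L_deg addnC].
apply/eqP; rewrite mulf_eq0; apply/orP; right; apply: contraR wn1 => h; apply/eqP.
apply: (@dominated_act_id L) => P.
apply: leq_trans (kostka_neq0_dominance P strict_addrho h) _.
by apply: leq_sum => i _; rewrite mnmDE addnK.
Qed.

End FrobeniusCharacter.

(** * Zero-one matrices and the characterization of Specht characters *)

Section ZeroOne.

Variables (n m : nat) (L : 'X_{1..n}).
Hypothesis L_decr : forall i j : 'I_n, (i <= j)%N -> (L j <= L i)%N.
Hypothesis L_deg : mdeg L = m.

Definition conj_part (j : 'I_m) : nat := #|[pred i : 'I_n | (j < L i)%N]|.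

(** Both sides count the boxes in the first [r] rows of the diagram of [L]. *)
Lemma conj_part_sum r :
  (\sum_j minn r (conj_part j) <= \sum_(i < n | i < r) L i)%N.
Proof.
have Lm i : (L i <= m)%N by rewrite -L_deg mdegE (bigD1 i) //= leq_addr.
have init j (i : 'I_n) : (i < conj_part j)%N -> (j < L i)%N.
  apply: contraTT; rewrite -!leqNgt => h.
  rewrite -[X in (_ <= X)%N](card_ord_lt (ltnW (ltn_ord i))); apply: subset_leq_card.
  apply/subsetP=> i'; rewrite !inE => h'; rewrite ltnNge; apply/negP => /L_decr; lia.
have le j : (minn r (conj_part j) <= \sum_(i < n | i < r) (j < L i))%N.
  have cn : (minn r (conj_part j) <= n)%N.
    by rewrite geq_min -[n in X in _ || X]card_ord max_card orbT.
  rewrite -{1}(card_ord_lt cn) -sum1_card [X in (X <= _)%N]big_mkcond [X in (_ <= X)%N]big_mkcond.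
  apply: leq_sum => i _; rewrite !inE leq_min; case: (i < r)%N => //=.
  by case: ifP => // /init ->.
apply: leq_trans (leq_sum _ (fun j _ => le j)) _.
rewrite exchange_big /=; apply: leq_sum => i _.
rewrite -[X in (_ <= X)%N](card_ord_lt (Lm i)) -sum1_card [X in (_ <= X)%N]big_mkcond.
by apply: leq_sum => j _; rewrite !inE; case: ifP.
Qed.

Implicit Type M : {ffun 'I_n * 'I_m -> 'I_m.+1}.

Definition zero_one M := [forall p, (M p <= 1)%N].

Lemma zero_one_col_bound M (P : pred 'I_n) (j : 'I_m) (c : 'I_n -> nat) : zero_one M -> margins c conj_part M ->
  (\sum_(i | P i) M (i, j) <= minn #|P| (conj_part j))%N.
Proof.
move=> /forallP M1 /andP[_ /forallP hj]; rewrite leq_min; apply/andP; split.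
  by rewrite -sum1_card; apply: leq_sum => i _; apply: M1.
by rewrite -(eqP (hj j)) [X in (_ <= X)%N](bigID P) /= leq_addr.
Qed.

(** The easy half of the Gale-Ryser theorem. *)
Lemma zero_one_dominance M c (P : pred 'I_n) : zero_one M -> margins c conj_part M ->
  (\sum_(i | P i) c i <= \sum_(i < n | i < #|P|) L i)%N.
Proof.
move=> M1 hM; apply: leq_trans (conj_part_sum _).
have /andP[/forallP hi _] := hM.
rewrite -(eq_bigr _ (fun i _ => eqP (hi i))) exchange_big /=.
by apply: leq_sum => j _; apply: zero_one_col_bound M1 hM.
Qed.

(** The bounds on the columns add up to the total of the first [r] rows, so all of them are
    attained. *)
Lemma zero_one_prefix M r (j : 'I_m) : zero_one M -> margins (fun i => L i) conj_part M ->
  (r <= n)%N -> (\sum_(i < n | i < r) M (i, j))%N = minn r (conj_part j).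
Proof.
move=> M1 hM rn; have /andP[/forallP hi _] := hM.
have bnd j' : (\sum_(i < n | i < r) M (i, j') <= minn r (conj_part j'))%N.
  have := @zero_one_col_bound M [pred i : 'I_n | (i < r)%N] j' _ M1 hM.
  by rewrite card_ord_lt.
apply/eqP; rewrite eqn_leq bnd /= leqNgt; apply/negP => lt.
have := conj_part_sum r.
rewrite -(eq_bigr _ (fun i _ => eqP (hi i))) exchange_big /= leqNgt => /negP[].
rewrite (bigD1 j) //= [X in (_ < X)%N](bigD1 j) //= -addSn leq_add //.
exact: leq_sum.
Qed.

Lemma zero_one_uniq M M' :
  zero_one M -> margins (fun i => L i) conj_part M ->
  zero_one M' -> margins (fun i => L i) conj_part M' -> M = M'.
Proof.
move=> M1 hM M1' hM'; apply/ffunP=> -[i j]; apply: val_inj => /=.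
have step X : zero_one X -> margins (fun i => L i) conj_part X ->
    (minn i.+1 (conj_part j) = X (i, j) + minn i (conj_part j))%N.
  move=> X1 hX; rewrite -(zero_one_prefix _ X1 hX (ltn_ord i)).
  rewrite -(zero_one_prefix _ X1 hX (ltnW (ltn_ord i))) (bigD1 i) //=.
  by congr addn; apply: eq_bigl => k; rewrite ltnS ltn_neqAle andbC.
by apply/eqP; rewrite -(eqn_add2r (minn i (conj_part j))) -step // -step.
Qed.

Lemma cfdot_permc_conj_le1 :
  '[permc m (fun i => L i), sgnc m * permc m conj_part] <= 1.
Proof.
rewrite cfdot_permc_sgn -?mdegE // lern1; apply/card_le1_eqP => M M'.
by rewrite !inE => /andP[h1 h2] /andP[h1' h2']; apply: zero_one_uniq.
Qed.

Lemma cfdot_permc_conj_eq0 (w : 'S_n) : w != 1%g ->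
  (rho n <= mnm_act (L + rho n) w)%MM ->
  '[permc m (fun i => (mnm_act (L + rho n) w - rho n)%MM i), sgnc m * permc m conj_part] = 0.
Proof.
move=> wn1 rw; rewrite cfdot_permc_sgn; last first.
  rewrite -mdegE; apply/eqP; rewrite -(eqn_add2r (mdeg (rho n))) -mdegD submK //.
  by rewrite mdeg_mnm_act mdegD L_deg.
rewrite eq_card0 // => M; rewrite !inE; apply: contraNF wn1 => /andP[hM M1].
by apply/eqP/(@dominated_act_id _ L) => P; apply: zero_one_dominance M1 hM.
Qed.

(** The constraints on [chi] and the uniqueness of the zero-one matrix leave only 1 for the
    norm of [chi] and for its inner product with [permc] of [L].  The other terms of [frob]
    are orthogonal to [chi], already because they are orthogonal to the sign twist of
    which [chi] is a part.  Hence [frob] - [chi] has norm 1 - 1 - 1 + 1. *)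
Lemma char_eq_frob (chi : 'CF([set: 'S_m])) :
  (forall c : 'I_n -> nat, permc m c \is a character) ->
  chi \is a character -> chi != 0 ->
  permc m (fun i => L i) - chi \is a character ->
  sgnc m * permc m conj_part - chi \is a character ->
  chi = frob m (L + rho n)%MM.
Proof.
move=> permc_char Nchi chi0 N1 N2.
have pos (phi psi : 'CF([set: 'S_m])) : phi \is a character -> psi \is a character -> 0 <= '[phi, psi].
  by move=> h1 h2; apply: natr_ge0; apply: Cnat_cfdot_char.
have Npi := permc_char (fun i => L i).
have Nsg : sgnc m * permc m conj_part \is a character.
  by rewrite -[X in X \is a _](subrK chi) rpredD.
have le1 : '[permc m (fun i => L i), chi] <= 1.
  apply: le_trans cfdot_permc_conj_le1.
  by rewrite -subr_ge0 -cfdotBr pos.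
have le2 : '[chi] <= '[permc m (fun i => L i), chi].
  by rewrite -subr_ge0 -cfdotBl pos.
have ge1 : 1 <= '[chi].
  have /natrP [k ek] := Cnat_cfdot_char Nchi Nchi.
  by rewrite ek ler1n lt0n; apply: contra chi0 => /eqP k0; rewrite -cfnorm_eq0 ek k0.
have e1 : '[chi] = 1 by apply/eqP; rewrite eq_le ge1 (le_trans le2).
have e2 : '[permc m (fun i => L i), chi] = 1.
  by apply/eqP; rewrite eq_le le1 (le_trans ge1).
have e3 : '[frob m (L + rho n)%MM, chi] = 1.
  rewrite /frob cfdot_suml (bigD1 1%g) /=; last by rewrite mnm_act1; apply: lem_addl.
  rewrite mnm_act1 addmK odd_perm1 expr0 scale1r e2 big1 ?addr0 // => w /andP[rw wn1].
  rewrite cfdotZl; apply/eqP; rewrite mulf_eq0; apply/orP; right.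
  rewrite eq_le pos // andbT -(cfdot_permc_conj_eq0 wn1 rw).
  by rewrite -subr_ge0 -cfdotBr pos.
apply/eqP; rewrite -subr_eq0 -cfnorm_eq0 cfdotBl !cfdotBr e1 e3 (frob_norm L_decr L_deg).
by rewrite cfdotC e3 conjC1 !subrr.
Qed.

End ZeroOne.

(** * Characters of submodules and of images of endomorphisms *)

Section Submodules.

Variables (gT : finGroupType) (G : {group gT}) (n : nat).
Variable rG : mx_representation algC G n.
Implicit Types U V W f P : 'M[algC]_n.

Lemma cfRepr_eq_module U V (modU : mxmodule rG U) (modV : mxmodule rG V) :
  (U :=: V)%MS -> cfRepr (submod_repr modU) = cfRepr (submod_repr modV).
Proof.
move=> e; apply: cfRepr_sim; apply/mx_rsim_iso.
exact: eqmx_iso.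
Qed.

Lemma cfRepr_submodule U V (modU : mxmodule rG U) (modV : mxmodule rG V) :
  (U <= V)%MS ->
  exists W (modW : mxmodule rG W), [/\ (W <= V)%MS, (U :&: W = 0)%MS, (U + W :=: V)%MS &
    cfRepr (submod_repr modV) = cfRepr (submod_repr modU) + cfRepr (submod_repr modW)].
Proof.
move=> sUV; have redV := mx_reducibleS modV (submx1 V) (mx_Maschke_pchar rG (algC'G_pchar G)).
have [W modW defV dx] := redV U modU sUV.
exists W, modW; split=> //.
- by apply: submx_trans (addsmxSr U W) _; rewrite defV.
- exact/mxdirect_addsP.
rewrite -(cfRepr_dadd (Representation (submod_repr modU)) (Representation (submod_repr modW))).
apply: cfRepr_sim.
exact: (mx_rsim_dadd (rU := Representation (submod_repr modU))
  (rV := Representation (submod_repr modW)) modV defV dx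
  (mx_rsim_refl _) (mx_rsim_refl _)).
Qed.

Lemma cfRepr_sub_char U V (modU : mxmodule rG U) (modV : mxmodule rG V) :
  (U <= V)%MS ->
  cfRepr (submod_repr modV) - cfRepr (submod_repr modU) \is a character.
Proof.
case/(cfRepr_submodule modU modV)=> W [modW [_ _ _ ->]].
by rewrite addrC addKr cfRepr_char.
Qed.

Lemma centgmx_module V f : centgmx rG f -> mxmodule rG V -> mxmodule rG (V *m f).
Proof.
move=> /centgmxP cf /mxmoduleP mV; apply/mxmoduleP=> x Gx.
by rewrite -mulmxA cf // mulmxA submxMr // mV.
Qed.

(** By Maschke's theorem, the image of [f] on [V] is isomorphic to a complement of its
    kernel in [V]. *)
Lemma cfRepr_quo_char V f (modV : mxmodule rG V) (modVf : mxmodule rG (V *m f)) :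
  centgmx rG f ->
  cfRepr (submod_repr modV) - cfRepr (submod_repr modVf) \is a character.
Proof.
move=> cf; have modK : mxmodule rG (V :&: kermx f)%MS.
  by rewrite capmx_module // kermx_centg_module.
have [W [modW [sWV tiKW defV eV]]] := cfRepr_submodule modK modV (capmxSl V _).
rewrite eV (_ : cfRepr (submod_repr modVf) = cfRepr (submod_repr modW)) ?addrK ?cfRepr_char //.
(* W is a complement of the kernel, so f is injective on W and has the same image. *)
have eWf : (W *m f :=: V *m f)%MS.
  have kf : (V :&: kermx f)%MS *m f = 0 by apply/sub_kermxP; apply: capmxSr.
  apply/eqmxP; rewrite submxMr //= -(eqmxMr f defV) addsmxMr addsmx_sub submx_refl andbT.
  by rewrite kf sub0mx.
have tiW : (W :&: kermx f)%MS = 0.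
  apply/eqP; rewrite -submx0 -tiKW sub_capmx sub_capmx capmxSl capmxSr andbT andbT.
  exact: submx_trans (capmxSl _ _) sWV.
have rW : \rank (W *m f) = \rank W by apply/mxrank_injP/eqP.
have sWf : (val_submod (1%:M : 'M_(\rank W)) *m f <= V *m f)%MS.
  by apply: submx_trans (_ : _ <= W *m f)%MS _; rewrite ?eWf // submxMr // val_submod1.
symmetry; apply: cfRepr_sim.
exists (in_submod (V *m f) (val_submod (1%:M : 'M_(\rank W)) *m f)).
- by rewrite -eWf rW.
- rewrite /row_free mxrank_in_submod //; apply/eqP.
  by rewrite (eqmxMr f (val_submod1 W)) rW.
move=> x Gx; rewrite -in_submodJ // -mulmxA (centgmxP cf) //.
rewrite [in LHS]in_submodE [RHS]in_submodE mulmxA; congr (_ *m _).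
rewrite mulmxA [RHS]mulmxA; congr (_ *m _).
by rewrite -val_submodE /= /submod_mx in_submodK // mxmodule_trans ?val_submodP.
Qed.

(** The trace on the image of a commuting idempotent is the trace on the whole space after
    composing with it. *)
Lemma cfRepr_idempotent P (modP : mxmodule rG P) : centgmx rG P -> P *m P = P ->
  forall x, x \in G -> cfRepr (submod_repr modP) x = \tr (P *m rG x).
Proof.
move=> cP PP x Gx; rewrite cfunE Gx mulr1n /= /submod_mx in_submodE.
set v1 := val_submod _; set i1 := in_submod _ _.
have v1P : v1 *m P = v1.
  have /submxP[X ->] : (v1 <= P)%MS by apply: val_submodP.
  by rewrite -mulmxA PP.
have PE : P *m (i1 *m v1) = P by rewrite mulmxA -in_submodE -val_submodE in_submodK.
rewrite mxtrace_mulC -{1}v1P -(mulmxA v1) (centgmxP cP) // (mulmxA v1) (mulmxA i1).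
by rewrite mxtrace_mulC (mulmxA i1) (mulmxA P) PE mxtrace_mulC.
Qed.

End Submodules.

(** * Right ideals of the group ring generated by stabilizer sums *)

Section GroupRing.

Variable gT : finGroupType.
Local Notation G := [set: gT]%G.
Local Notation N := #|G|.
Local Notation aG := (regular_repr algC G).
Implicit Types (u v : 'rV[algC]_N) (x y : gT).

Definition gdelta x : 'rV[algC]_N := delta_mx 0 (gring_index G x).

Lemma gdeltaM x y : gdelta x *m aG y = gdelta (x * y).
Proof. by rewrite /gdelta -rowE rowK gring_indexK ?inE. Qed.

(** Left multiplication by [u] in the group ring, which commutes with the regular
    representation; its image is the right ideal generated by [u]. *)
Definition lmul u : 'M[algC]_N := \matrix_i (u *m aG (enum_val i)).

Lemma gdelta_lmul x u : gdelta x *m lmul u = u *m aG x.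
Proof. by rewrite /gdelta -rowE rowK gring_indexK ?inE. Qed.

Lemma row_gdelta i (f : 'M[algC]_N) : row i f = gdelta (enum_val i) *m f.
Proof. by rewrite /gdelta gring_valK -rowE. Qed.

Lemma lmul_centgmx u : centgmx aG (lmul u).
Proof.
apply/centgmxP=> x _; apply/row_matrixP=> i; rewrite !row_gdelta !mulmxA.
by rewrite gdeltaM !gdelta_lmul repr_mxM ?inE // mulmxA.
Qed.

Lemma lmulM u v : lmul u *m lmul v = lmul (u *m lmul v).
Proof.
apply/row_matrixP=> i; rewrite !row_gdelta mulmxA !gdelta_lmul -!mulmxA.
by rewrite (centgmxP (lmul_centgmx v)) ?inE.
Qed.

Lemma lmulZ c u : lmul (c *: u) = c *: lmul u.
Proof.
by apply/row_matrixP=> i; rewrite !row_gdelta -scalemxAr !gdelta_lmul scalemxAl.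
Qed.

Lemma lmul_id u : (u <= lmul u)%MS.
Proof.
have {1}-> : u = row (gring_index G 1) (lmul u).
  by rewrite rowE gdelta_lmul repr_mx1 mulmx1.
exact: row_sub.
Qed.

Lemma lmul_module u : mxmodule aG (lmul u).
Proof. by rewrite -[lmul u]mul1mx centgmx_module ?lmul_centgmx ?mxmodule1. Qed.

Lemma cyclic_mx_lmul u : (cyclic_mx aG u :=: lmul u)%MS.
Proof.
apply/eqmxP; rewrite cyclic_mx_sub ?lmul_module ?lmul_id //=.
apply/row_subP=> i; rewrite row_gdelta gdelta_lmul; apply/cyclic_mxP.
by exists (aG (enum_val i)); rewrite ?envelop_mx_id ?inE.
Qed.

End GroupRing.

Section StabilizerModule.

Variables (m : nat) (C : finType) (f0 : {ffun 'I_m -> C}) (b : bool).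
Local Notation G := [set: 'S_m]%G.
Local Notation aG := (regular_repr algC G).

(** The trivial character and the sign character, treated together. *)
Definition twist (s : 'S_m) : algC := (-1) ^+ (b && odd_perm s).

(** For the row word and the trivial character, and for the column word and the sign, these
    are the two factors of a Young symmetrizer. *)
Definition stab_sum : 'rV[algC]_#|G| :=
  \sum_(s | fixed_by f0 s) twist s *: gdelta s.

Local Notation R := [pred s | fixed_by f0 s].

Lemma twistM s t : twist (s * t)%g = twist s * twist t.
Proof. by rewrite /twist odd_permM; case: b; rewrite ?mulr1 //= signr_addb. Qed.

Lemma twist_sqr s : twist s * twist s = 1.
Proof. by rewrite -expr2 sqrr_sign. Qed.

Lemma fixed_byM s t : fixed_by f0 t -> fixed_by f0 (s * t) = fixed_by f0 s.
Proof. by rewrite !fixed_byE => /eqP h; rewrite -fcompM h. Qed.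

Lemma stab_sumM s : fixed_by f0 s -> stab_sum *m aG s = twist s *: stab_sum.
Proof.
move=> fs; rewrite /stab_sum mulmx_suml scaler_sumr [RHS](reindex_inj (mulIg s)) /=.
apply: eq_big => [t|t _]; first by rewrite fixed_byM.
by rewrite -scalemxAl gdeltaM scalerA twistM mulrCA twist_sqr mulr1.
Qed.

Lemma card_stab_neq0 : #|R|%:R != 0 :> algC.
Proof.
rewrite pnatr_eq0 -lt0n; apply/card_gt0P; exists 1%g; rewrite inE.
by apply/forallP=> x; rewrite perm1.
Qed.

Lemma lmul_stab_sum_sqr : lmul stab_sum *m lmul stab_sum = #|R|%:R *: lmul stab_sum.
Proof.
rewrite lmulM -lmulZ; congr lmul; rewrite {1}/stab_sum mulmx_suml.
rewrite -(sum1_card R) natr_sum scaler_suml; apply: eq_bigr => s fs.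
by rewrite -scalemxAl gdelta_lmul stab_sumM // scalerA twist_sqr.
Qed.

(** For each [x], the only solution [s] of s x g = x is a conjugate of the inverse of [g],
    so its sign is that of [g]; what remains is to count the [x] for which it is in the
    stabilizer. *)
Lemma trace_stab_sum g : \tr (lmul stab_sum *m aG g) =
  twist g * #|[pred x | fixed_by (fcomp f0 x) g]|%:R.
Proof.
have termE i : (lmul stab_sum *m aG g) i i =
    \sum_(s | fixed_by f0 s) twist s * (s * enum_val i * g == enum_val i)%g%:R.
  transitivity ((row i (lmul stab_sum *m aG g)) 0 i); first by rewrite [RHS]mxE.
  rewrite row_gdelta mulmxA gdelta_lmul /stab_sum -mulmxA -repr_mxM ?inE //.
  rewrite mulmx_suml summxE; apply: eq_bigr => s _.
  rewrite -scalemxAl gdeltaM mulgA mxE /gdelta mxE eqxx /=; congr (_ * _%:R).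
  by rewrite -(inj_eq enum_val_inj) gring_indexK ?inE // eq_sym.
rewrite /mxtrace (eq_bigr _ (fun i _ => termE i)).
rewrite (reindex (gring_index G)) /=; last first.
  exists enum_val => x _; [by rewrite gring_indexK ?inE | exact: gring_valK].
under eq_bigr => x _ do rewrite gring_indexK ?inE //.
have xE x : \sum_(s | fixed_by f0 s) twist s * (s * x * g == x)%g%:R =
    twist g * (fixed_by (fcomp f0 x^-1) g)%:R.
  have e s : (s * x * g == x)%g = (s == x * g^-1 * x^-1)%g.
    by apply/eqP/eqP => [h|->]; [rewrite -{1}h !mulgK | rewrite !mulgKV].
  have fE : fixed_by (fcomp f0 x^-1) g = fixed_by f0 (x * g^-1 * x^-1).
    rewrite !fixed_byE !fcompM -(inj_eq (can_inj (fcompK (x * g^-1)%g))) !fcompM.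
    by rewrite !mulgA mulgKV mulgV fcomp1 eq_sym.
  rewrite fE big_mkcond (bigD1 (x * g^-1 * x^-1)%g) //= big1 => [|s /negbTE ne].
    rewrite addr0 e eqxx mulr1; case: ifP => _; rewrite ?mulr1 ?mulr0 //.
    by rewrite /twist !odd_permM !odd_permV; case: b => //=; rewrite addbAC addbb.
  by rewrite e ne mulr0; case: ifP.
rewrite (eq_bigr _ (fun x _ => xE x)) -mulr_sumr -natr_sum; congr (_ * _%:R).
rewrite -sum1_card (reindex_inj invg_inj) /= [RHS]big_mkcond; apply: eq_bigr => x _.
by rewrite invgK inE; case: fixed_by.
Qed.

Lemma card_fixed_translates c g : has_content f0 c ->
  #|[pred x | fixed_by (fcomp f0 x) g]| = (#|R| * fix_count c g)%N.
Proof.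
move=> h0; rewrite -sum1_card (partition_big (fcomp f0)
   (fun f => has_content f c && fixed_by f g)) /=; last first.
  by move=> x; rewrite inE has_content_fcomp h0 => ->.
rewrite mulnC /fix_count -sum_nat_const; apply: eq_big => [f|f]; first by rewrite inE.
case/andP=> hf fg; have [t et] := has_content_conj h0 hf.
rewrite -sum1_card (reindex_inj (mulgI t)) /=; apply: eq_bigl => x; rewrite !inE.
have -> : (fcomp f0 (t * x) == f) = fixed_by f0 x.
  by rewrite fixed_byE et -(inj_eq (can_inj (fcompK t^-1%g))) !fcompM mulKg mulVg fcomp1.
case hx: (fixed_by f0 x); rewrite ?andbF ?andbT //.
move: hx; rewrite fixed_byE => /eqP hx.
by rewrite -fcompM hx -et fg.
Qed.

(** Divided by the order of the stabilizer, [stab_sum] is an idempotent, so the character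
    is a trace; that trace counts the fixed words, each as many times as the order of the
    stabilizer. *)
Lemma cfRepr_stab_sum c : has_content f0 c ->
  cfRepr (submod_repr (lmul_module stab_sum)) = sgnc m ^+ b * permc m c.
Proof.
move=> h0; set P := #|R|%:R^-1 *: lmul stab_sum.
have eP : (lmul stab_sum :=: P)%MS.
  by apply/eqmx_sym/eqmx_scale; rewrite invr_eq0 card_stab_neq0.
have modP : mxmodule aG P by rewrite -(eqmx_module _ eP) lmul_module.
rewrite (cfRepr_eq_module (lmul_module stab_sum) modP eP).
have cP : centgmx aG P by rewrite /P -lmulZ lmul_centgmx.
have PP : P *m P = P.
  rewrite /P -scalemxAl -scalemxAr lmul_stab_sum_sqr !scalerA.
  by rewrite mulfVK ?card_stab_neq0.
apply/cfunP=> g; rewrite (cfRepr_idempotent modP cP PP) ?inE //.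
rewrite /P -scalemxAl mxtraceZ trace_stab_sum (card_fixed_translates _ h0) natrM.
rewrite mulrCA mulKf ?card_stab_neq0 // cfunE permcE; congr (_ * _).
by rewrite /twist; case: (b); rewrite ?expr1 ?expr0 ?sgncE // cfun1E inE.
Qed.

End StabilizerModule.

Lemma permc_char m (C : finType) (c : C -> nat) : permc m c \is a character.
Proof.
case: (eqVneq (\sum_b c b)%N m) => [hc|/permc_eq0 ->]; last exact: rpred0.
have [f0 h0] := has_content_ex hc.
by have := cfRepr_stab_sum false h0; rewrite expr0 mul1r => <-; apply: cfRepr_char.
Qed.

(** * Specht characters *)

Lemma part_nth_decr lam i j : is_part lam -> (i <= j)%N -> (nth 0 lam j <= nth 0 lam i)%N.
Proof.
move=> /andP[srt _] ij.
case: (ltnP j (size lam)) => hj; last by rewrite nth_default.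
apply: (sorted_leq_nth (leT := geq)) => //; last by rewrite inE (leq_ltn_trans ij).
- by move=> x y z h1 h2; apply: leq_trans h2 h1.
- exact: leqnn.
Qed.

Section Specht.

Variables (n m : nat) (lam : seq nat).
Hypothesis lam_part : is_part lam.
Hypothesis lam_size : (size lam <= n.+1)%N.
Hypothesis lam_sum : sumn lam = m.

Definition part_mnm : 'X_{1..n.+1} := [multinom nth 0%N lam i | i < n.+1].

Lemma part_mnm_decr (i j : 'I_n.+1) : (i <= j)%N -> (part_mnm j <= part_mnm i)%N.
Proof. by rewrite !mnmE; apply: part_nth_decr. Qed.

Lemma mdeg_part_mnm : mdeg part_mnm = m.
Proof.
rewrite mdegE -lam_sum sumnE (big_nth 0%N) big_mkord.
rewrite (big_ord_widen n.+1 (nth 0%N lam) lam_size) [RHS]big_mkcond.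
apply: eq_bigr => i _; rewrite mnmE; case: ltnP => // h.
by rewrite nth_default.
Qed.

(** The default value of [inord] is never used, as boxes lie in one of the rows of [lam]. *)
Definition row_of : {ffun 'I_m -> 'I_n.+1} := [ffun i : 'I_m => inord (reshape_index lam i)].
Definition col_of : {ffun 'I_m -> 'I_m} := [ffun i : 'I_m => insubd i (reshape_offset lam i)].

Lemma row_ofE i : row_of i = reshape_index lam i :> nat.
Proof.
rewrite ffunE inordK //; apply: leq_trans lam_size; apply: reshape_indexP.
by rewrite lam_sum.
Qed.

Lemma col_of_lt (i : 'I_m) : (reshape_offset lam i < part_mnm (row_of i))%N.
Proof. by rewrite mnmE row_ofE; apply: reshape_offsetP; rewrite lam_sum. Qed.

Lemma part_mnm_le i : (part_mnm i <= m)%N.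
Proof. by rewrite -mdeg_part_mnm mdegE (bigD1 i) //= leq_addr. Qed.

Lemma col_ofE i : col_of i = reshape_offset lam i :> nat.
Proof.
rewrite ffunE insubdK // -topredE /=.
exact: leq_trans (col_of_lt i) (part_mnm_le _).
Qed.

(** Boxes are determined by their coordinates. *)
Lemma box_content (r : 'I_n.+1) (c : 'I_m) :
  #|[pred i | (row_of i, col_of i) == (r, c)]| = (c < part_mnm r)%N.
Proof.
have boxE i : ((row_of i, col_of i) == (r, c)) =
    (reshape_index lam i == r) && (reshape_offset lam i == c).
  by rewrite xpair_eqE -!val_eqE /= row_ofE col_ofE.
case: (ltnP c (part_mnm r)) => h; last first.
  rewrite eq_card0 // => i; rewrite !inE boxE.
  apply/negP => /andP[/eqP hr /eqP hc]; have := col_of_lt i.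
  rewrite hc (_ : row_of i = r); first by rewrite ltnNge h.
  by apply: val_inj; rewrite /= row_ofE.
have hi : (flatten_index lam r c < m)%N.
  rewrite -[X in (_ < X)%N]lam_sum; apply: flatten_indexP; move: h; rewrite mnmE //.
have hc : (c < nth 0 lam r)%N by move: h; rewrite mnmE.
rewrite (eq_card1 (x := Ordinal hi)) // => i; rewrite !inE boxE -val_eqE /=.
apply/andP/eqP => [[/eqP <- /eqP <-]|->]; first by rewrite reshape_indexK.
by rewrite flatten_indexKl // flatten_indexKr // !eqxx.
Qed.

Lemma row_of_content : has_content row_of part_mnm.
Proof.
apply/forallP=> r; apply/eqP.
rewrite (card_fiber_fst (fun i => (row_of i, col_of i)) r).
under eq_bigr do rewrite box_content.
rewrite -[RHS](card_ord_lt (part_mnm_le r)) -[RHS]sum1_card [RHS]big_mkcond.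
by apply: eq_bigr => c _; rewrite inE; case: ifP.
Qed.

Lemma col_of_content : has_content col_of (conj_part part_mnm).
Proof.
apply/forallP=> c; apply/eqP.
rewrite (card_fiber_snd (fun i => (row_of i, col_of i)) c).
under eq_bigr do rewrite box_content.
rewrite -[RHS]sum1_card [RHS]big_mkcond.
by apply: eq_bigr => r _; rewrite inE; case: ifP.
Qed.

Lemma mem_row_group s : (s \in row_group m lam) = fixed_by row_of s.
Proof.
rewrite inE; apply: eq_forallb => i.
by rewrite -val_eqE /= !row_ofE.
Qed.

Lemma mem_col_group s : (s \in col_group m lam) = fixed_by col_of s.
Proof.
rewrite inE; apply: eq_forallb => i.
by rewrite -val_eqE /= !col_ofE.
Qed.

Lemma row_col_trivial s : fixed_by row_of s -> fixed_by col_of s -> s = 1%g.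
Proof.
move=> /forallP hr /forallP hc; apply/permP=> i; rewrite perm1.
have : (#|[pred j | (row_of j, col_of j) == (row_of i, col_of i)]| <= 1)%N.
  by rewrite box_content leq_b1.
by move/card_le1_eqP; apply; rewrite !inE ?(eqP (hr i)) ?(eqP (hc i)).
Qed.

Lemma young_symmetrizerE :
  young_symmetrizer m lam = stab_sum col_of true *m lmul (stab_sum row_of false).
Proof.
rewrite /young_symmetrizer /stab_sum mulmx_suml exchange_big /=.
apply: eq_big => [t|t _]; first by rewrite mem_col_group.
rewrite -scalemxAl gdelta_lmul mulmx_suml scaler_sumr.
apply: eq_big => [s|s _]; first by rewrite mem_row_group.
by rewrite -scalemxAl gdeltaM /twist /= expr0 scale1r.
Qed.

(** The coefficient of the identity is 1, since no other permutation preserves both rows and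
    columns. *)
Lemma young_symmetrizer_neq0 : young_symmetrizer m lam != 0.
Proof.
apply/eqP => /matrixP/(_ 0 (gring_index [set: 'S_m] 1%g)) /eqP.
rewrite /young_symmetrizer summxE mxE.
rewrite (bigD1 1%g) /=; last by rewrite mem_row_group fixed_byE fcomp1.
rewrite summxE (bigD1 1%g) /=; last by rewrite mem_col_group fixed_byE fcomp1.
have inj (s : 'S_m) : gring_index [set: 'S_m] 1%g = gring_index [set: 'S_m] s -> s = 1%g.
  by move/(congr1 enum_val); rewrite !gring_indexK ?inE.
rewrite !mxE mulg1 !eqxx odd_perm1 mulr1 expr0 !big1 ?addr0 ?oner_eq0 //.
  move=> s /andP[hs sn1]; rewrite summxE big1 // => t ht; rewrite !mxE eqxx /=.
  case: eqP => [/inj e|_]; last by rewrite mulr0.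
  case/eqP: sn1; apply: row_col_trivial; rewrite -?mem_row_group //.
  have es : s = (t^-1)%g by rewrite -(mulgK t s) e mul1g.
  rewrite es fixed_byE -(inj_eq (can_inj (fcompK t))) fcompM mulgV fcomp1 eq_sym -fixed_byE.
  by rewrite -mem_col_group.
move=> t /andP[ht tn1]; rewrite !mxE mul1g eqxx /=.
by case: eqP => [/inj e|_]; [rewrite e eqxx in tn1 | rewrite mulr0].
Qed.

(** With e = a b, the ideal e A is contained in a A, and it is the image of b A under left
    multiplication by a. *)
Lemma specht_char_frob : specht_char m lam = frob m (part_mnm + rho n.+1)%MM.
Proof.
rewrite /specht_char /specht_repr.
set e := young_symmetrizer m lam.
rewrite (cfRepr_eq_module _ (lmul_module e) (cyclic_mx_lmul e)).
have eE : lmul e = lmul (stab_sum col_of true) *m lmul (stab_sum row_of false).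
  by rewrite /e young_symmetrizerE lmulM.
apply: (char_eq_frob part_mnm_decr mdeg_part_mnm).
- by move=> c; apply: permc_char.
- exact: cfRepr_char.
- apply/eqP => /cfunP/(_ 1%g); rewrite cfRepr1 cfunE => /eqP; rewrite pnatr_eq0 mxrank_eq0.
  apply/negP; apply: contra young_symmetrizer_neq0 => /eqP e0.
  by rewrite -submx0 -e0 lmul_id.
- have := cfRepr_stab_sum false row_of_content; rewrite expr0 mul1r => <-.
  by apply: cfRepr_sub_char; rewrite eE submxMl.
have := cfRepr_stab_sum true col_of_content; rewrite expr1 => <-.
have modQ : mxmodule (regular_repr algC [set: 'S_m])
   (lmul (stab_sum col_of true) *m lmul (stab_sum row_of false)) by rewrite -eE lmul_module.
rewrite (cfRepr_eq_module (lmul_module e) modQ); last by rewrite eE.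
by apply: cfRepr_quo_char; apply: lmul_centgmx.
Qed.

End Specht.

(** * Heisenberg products of permutation characters *)

Lemma iota_perm_ex a b (s : 'S_(a + b)) :
  (forall i : 'I_a, exists j : 'I_a, s (lshift b i) = lshift b j) ->
  exists u, s = iota_perm u.
Proof.
move=> /fin_all_exists [f hf].
have f_inj : injective f.
  by move=> i j e; apply: (@lshift_inj a b); apply: (@perm_inj _ s); rewrite !hf e.
have /fin_all_exists [g hg] : forall j, exists k, s (rshift a j) = rshift a k.
  move=> j; case: (splitP (s (rshift a j))) => [i|k] e; last first.
    by exists k; apply: val_inj.
  have [i' ei'] : exists i', f i' = i by exists (((perm f_inj)^-1)%g i); rewrite -(permE f_inj) permKV.
  have : s (lshift b i') = s (rshift a j) by apply: val_inj; rewrite hf ei' /= e.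
  by move/perm_inj/eqP; rewrite eq_shift.
have g_inj : injective g.
  by move=> i j e; apply: (@rshift_inj a b); apply: (@perm_inj _ s); rewrite !hg e.
exists (perm f_inj, perm g_inj); apply/permP=> i; rewrite -[i]splitK.
by case: (split i) => j /=; rewrite ?(iota_perm_lshift, iota_perm_rshift) permE ?hf ?hg.
Qed.

Lemma cfdot_pushforward (aT rT : finGroupType) (f : {morphism [set: aT] >-> rT})
    (f_inj : ('injm f)%g) (phi : 'CF([set: aT])) (chi : 'CF([set: rT])) :
  '[cf_pushforward f_inj phi, chi] = '[phi, cf_pullback f chi].
Proof.
rewrite /cf_pushforward -Frobenius_reciprocity !cfdotE card_injm //; congr (_ * _).
rewrite (eq_bigl (mem (f @: [set: aT]))) => [|y]; last by rewrite /= morphimEdom.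
rewrite big_imset /=; last by move=> u v _ _; apply: (injmP f_inj); rewrite inE.
apply: eq_bigr => u _.
by rewrite cfIsomE ?inE // cfResE ?subsetT ?mem_morphim ?inE // cf_pullbackE.
Qed.

Section HeisenbergWords.

Variables (p q r : nat) (X Y : finType) (ca : X -> nat) (cb : Y -> nat).
Local Notation m := (p + (q + r))%N.
Local Notation A := (option X * option Y)%type.
Local Notation H := ('S_p * 'S_q * 'S_r)%type.
Implicit Type F : {ffun 'I_m -> A}.

Hypothesis ca_sum : (\sum_a ca a)%N = (p + q)%N.
Hypothesis cb_sum : (\sum_b cb b)%N = (q + r)%N.

(** Words in the alphabet of the letters x_a = (Some a, None), y_b = (None, Some b) and
    x_a y_b = (Some a, Some b), with prescribed numbers of occurrences of each x_a and y_b,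
    alone or in a pair. *)
Definition heis_content F :=
  [&& [forall a, #|[pred x | (F x).1 == Some a]| == ca a],
      [forall b, #|[pred x | (F x).2 == Some b]| == cb b] &
      [forall x, F x != (None, None)]].

Definition heis_margins D (g : {ffun A -> 'I_D}) :=
  [&& [forall a, \sum_b g (Some a, b) == ca a]%N,
      [forall b, \sum_a g (a, Some b) == cb b]%N & g (None, None) == 0%N :> nat].

Lemma sum_heis_margins D (chi : 'CF([set: 'S_m])) : (m < D)%N ->
  \sum_(g : {ffun A -> 'I_D} | heis_margins g) '[permc m (fun z => g z), chi] =
  (m`!)%:R^-1 * \sum_(F | heis_content F) \sum_(s | fixed_by F s) (chi s)^*.
Proof.
move=> mD; pose cont F : {ffun A -> 'I_D} :=
  [ffun z => insubd (Ordinal (leq_ltn_trans (leq0n m) mD)) #|[pred x | F x == z]|].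
have contE F z : cont F z = #|[pred x | F x == z]| :> nat.
  rewrite ffunE insubdK // -topredE /=; apply: (leq_ltn_trans _ mD).
  by rewrite -[X in (_ <= X)%N]card_ord max_card.
have contP F : heis_margins (cont F) = heis_content F.
  congr [&& _, _ & _].
  - by apply: eq_forallb => a; rewrite card_fiber_fst; under eq_bigr do rewrite contE.
  - by apply: eq_forallb => b; rewrite card_fiber_snd; under eq_bigr do rewrite contE.
  rewrite contE; apply/eqP/forallP => [/card0_eq h x|h].
    by have := h x; rewrite inE => ->.
  by apply: eq_card0 => x; rewrite inE (negbTE (h x)).
rewrite [in RHS](partition_big cont (@heis_margins D)) /=; last by move=> F; rewrite contP.
rewrite mulr_sumr; apply: eq_bigr => g hg.
rewrite cfdotE cardsT card_Sn; congr (_ * _).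
rewrite [LHS](eq_bigl xpredT) => [|s]; last by rewrite inE.
rewrite (permc_sum (fun s => (chi s)^*)); apply: eq_bigl => F.
have -> : has_content F (fun z => g z) = (cont F == g).
  apply/forallP/eqP => [h|<- z]; last by rewrite contE.
  by apply/ffunP=> z; apply: val_inj; rewrite /= contE (eqP (h z)).
by case: eqP => [e|]; rewrite ?andbF // -contP e hg.
Qed.

(** The type of a letter says whether an x and whether a y occurs in it; this word has the
    types of the three blocks of H_i, of sizes p, q and r. *)
Definition type_word : {ffun 'I_m -> bool * bool} := [ffun x =>
  match split x with
  | inl _ => (true, false)
  | inr y => match split y with inl _ => (true, true) | inr _ => (false, true) end
  end].

Definition letter_type (z : A) : bool * bool := (isSome z.1, isSome z.2).

Definition types F : {ffun 'I_m -> bool * bool} := [ffun x => letter_type (F x)].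

Lemma types_fcomp F s : types (fcomp F s) = fcomp (types F) s.
Proof. by apply/ffunP=> x; rewrite !ffunE. Qed.

Definition type_content (z : bool * bool) : nat :=
  if z.1 then (if z.2 then q else p) else (if z.2 then r else 0%N).

Lemma type_contentP (t : {ffun 'I_m -> bool * bool}) :
  #|[pred x | (t x).1 == true]| = (p + q)%N ->
  #|[pred x | (t x).2 == true]| = (q + r)%N ->
  #|[pred x | t x == (false, false)]| = 0%N ->
  has_content t type_content.
Proof.
move=> h1 h2 h0; have h3 : #|[pred x | (t x).1 == false]| = r.
  have hc := etrans (cardC [pred x | (t x).1 == true]) (card_ord m).
  have e : #|[predC [pred x | (t x).1 == true]]| = #|[pred x | (t x).1 == false]|.
    by apply: eq_card => x; rewrite !inE; case: (t x).1.
  by move: hc; rewrite h1 e; lia.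
move: h1 h2 h3; rewrite !card_fiber_fst card_fiber_snd !big_bool /= h0 addn0 => h1 h2 h3.
have solve (x y z : nat) : (x + y = p + q -> x + z = q + r -> z = r -> x = q /\ y = p)%N.
  by lia.
have [h4 h5] := solve _ _ _ h1 h2 h3.
by apply/forallP=> -[[] []]; apply/eqP.
Qed.

(** The total numbers of x and of y and the length of the word determine the number of
    letters of each type. *)
Lemma heis_content_types F : heis_content F -> has_content (types F) type_content.
Proof.
case/and3P => /forallP ha /forallP hb /forallP h0.
have cardS (T : finType) (h : 'I_m -> option T) (c : T -> nat) :
    (forall z, #|[pred x | h x == Some z]| == c z) ->
    #|[pred x | isSome (h x) == true]| = (\sum_z c z)%N.
  move=> hc; rewrite -sum1_card.
  (* Each defined value of h is counted once, at the letter it equals. *)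
  rewrite (eq_bigr (fun x => \sum_z (h x == Some z))%N); last first.
    move=> x; rewrite inE; case: (h x) => // z0 _.
    by rewrite (bigD1 z0) //= eqxx big1 // => z /negbTE nz; rewrite -[_ == _]/(z0 == z) eq_sym nz.
  rewrite exchange_big /=; apply: eq_bigr => z _.
  rewrite -(eqP (hc z)) -sum1_card big_mkcond [RHS]big_mkcond; apply: eq_bigr => x _.
  by rewrite !inE; case: (h x) => //= z0; case: (_ == _).
apply: type_contentP.
- apply: etrans ca_sum; rewrite -(cardS _ (fun x => (F x).1) _ ha).
  by apply: eq_card => x; rewrite !inE ffunE.
- apply: etrans cb_sum; rewrite -(cardS _ (fun x => (F x).2) _ hb).
  by apply: eq_card => x; rewrite !inE ffunE.
apply: eq_card0 => x; rewrite !inE ffunE /letter_type.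
by have := h0 x; case: (F x) => [[a|] [b|]].
Qed.

Lemma type_word_l i : type_word (lshift (q + r) i) = (true, false).
Proof. by rewrite ffunE -[lshift _ i]/(unsplit (inl i)) unsplitK. Qed.

Lemma type_word_m j : type_word (rshift p (lshift r j)) = (true, true).
Proof.
rewrite ffunE -[rshift p _]/(unsplit (inr _)) unsplitK.
by rewrite -[lshift _ j]/(unsplit (inl j)) unsplitK.
Qed.

Lemma type_word_r k : type_word (rshift p (rshift q k)) = (false, true).
Proof.
rewrite ffunE -[rshift p _]/(unsplit (inr _)) unsplitK.
by rewrite -[rshift _ k]/(unsplit (inr k)) unsplitK.
Qed.

Lemma ord3_ind (P : 'I_m -> Prop) :
  (forall i, P (lshift (q + r) i)) -> (forall j, P (rshift p (lshift r j))) ->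
  (forall k, P (rshift p (rshift q k))) -> forall x, P x.
Proof.
move=> h1 h2 h3 x; rewrite -[x]splitK; case: (split x) => //= y.
by rewrite -[y]splitK; case: (split y).
Qed.

Lemma card_ord3 (P : pred 'I_m) :
  #|P| = (\sum_i P (lshift (q + r) i) + (\sum_j P (rshift p (lshift r j)) +
           \sum_k P (rshift p (rshift q k))))%N.
Proof.
rewrite -sum1_card big_mkcond big_split_ord /= big_split_ord /=.
by [].

Qed.

Lemma type_word_content : has_content type_word type_content.
Proof.
apply: type_contentP; rewrite card_ord3 /=;
  under eq_bigr do rewrite type_word_l;
  under [X in (_ + (X + _))%N]eq_bigr do rewrite type_word_m;
  under [X in (_ + (_ + X))%N]eq_bigr do rewrite type_word_r;
  rewrite /= !sum_nat_const !card_ord; lia.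
Qed.

Lemma heis_targetE s : fixed_by type_word s -> exists u : H, s = heis_target u.
Proof.
move=> /forallP hs.
have /iota_perm_ex [[u v] es] : forall i, exists j, s (lshift (q + r) i) = lshift (q + r) j.
  move=> i; have := eqP (hs (lshift _ i)); rewrite type_word_l.
  by move: (s _); apply: ord3_ind => [j _|j|k]; rewrite ?type_word_m ?type_word_r //; exists j.
have /iota_perm_ex [[v1 v2] ev] : forall j, exists j', v (lshift r j) = lshift r j'.
  move=> j; have := eqP (hs (rshift p (lshift r j))); rewrite type_word_m es iota_perm_rshift /=.
  rewrite -[v _]splitK; case: (split _) => j' /=; first by exists j'.
  by rewrite type_word_r.
by exists (u, v1, v2); rewrite es ev.
Qed.

Lemma heis_target_fixed (u : H) : fixed_by type_word (heis_target u).
Proof.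
apply/forallP; apply: ord3_ind => i; apply/eqP; rewrite /heis_target.
- by rewrite iota_perm_lshift !type_word_l.
- by rewrite iota_perm_rshift iota_perm_lshift !type_word_m.
- by rewrite iota_perm_rshift iota_perm_rshift !type_word_r.
Qed.

Lemma heis_target_inj : injective (@heis_target p q r).
Proof. by move=> u v e; apply: (injmP (heis_target_injm p q r)); rewrite ?inE. Qed.

Lemma sum_stab_type_word (E : 'S_m -> algC) (P : pred 'S_m) :
  (forall s, P s -> fixed_by type_word s) ->
  \sum_(s | P s) E s = \sum_(u : H | P (heis_target u)) E (heis_target u).
Proof.
move=> hP.
transitivity (\sum_(s in [set heis_target u | u in [set u : H | P (heis_target u)]]) E s).
  apply: eq_bigl => s; apply/idP/imsetP => [Ps|[u]]; last by rewrite inE => Pu ->.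
  by have [u e] := heis_targetE (hP _ Ps); exists u; rewrite ?inE -?e.
rewrite big_imset /=; last by move=> u v _ _; apply: heis_target_inj.
by apply: eq_bigl => u; rewrite inE.
Qed.

Lemma card_stab_type_word : #|[pred s | fixed_by type_word s]|%:R = #|{: H}|%:R :> algC.
Proof.
rewrite -!sum1_card !natr_sum.
rewrite (@sum_stab_type_word (fun=> 1%:R) (fun s => fixed_by type_word s)) //.
by apply: eq_bigl => u; rewrite heis_target_fixed.
Qed.

Lemma heis_content_fcomp F s : heis_content (fcomp F s) = heis_content F.
Proof.
congr [&& _, _ & _].
- apply: eq_forallb => a; congr (_ == _).
  rewrite -!sum1_card [RHS](reindex_inj (@perm_inj _ s)) /=.
  by apply: eq_bigl => x; rewrite !inE fcompE.
- apply: eq_forallb => b; congr (_ == _).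
  rewrite -!sum1_card [RHS](reindex_inj (@perm_inj _ s)) /=.
  by apply: eq_bigl => x; rewrite !inE fcompE.
apply/forallP/forallP => h x; last by rewrite fcompE.
by have := h (s^-1%g x); rewrite fcompE permKV.
Qed.

(** Inducing from H_i: each word can be rearranged into one with types [type_word], in as
    many ways as H_i has elements. *)
Lemma sum_heis_content (S : {ffun 'I_m -> A} -> algC) :
  (forall F s, S (fcomp F s) = S F) ->
  #|{: H}|%:R * \sum_(F | heis_content F) S F =
  (m`!)%:R * \sum_(F | heis_content F && (types F == type_word)) S F.
Proof.
move=> hS; rewrite mulr_sumr.
rewrite (eq_bigr (fun F => \sum_(x : 'S_m | types (fcomp F x) == type_word) S (fcomp F x))); last first.
  move=> F /heis_content_types hF; have [x0 e0] := has_content_conj hF type_word_content.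
  rewrite (reindex_inj (mulIg x0)) /= -card_stab_type_word -sum1_card natr_sum mulr_suml.
  apply: eq_big => [s|s _]; last by rewrite mul1r hS.
  by rewrite inE fixed_byE types_fcomp -fcompM -e0.
rewrite (exchange_big_dep xpredT) //= -card_Sn -sum1_card natr_sum mulr_suml.
rewrite [RHS](eq_bigl xpredT) => [|x]; last by rewrite inE.
apply: eq_bigr => x _; rewrite mul1r [RHS](reindex_inj (can_inj (fcompK x))) /=.
by apply: eq_bigl => F; rewrite heis_content_fcomp.
Qed.

(** A word of length p + q and a word of length q + r, overlapping in the middle block. *)
Definition glue (f : {ffun 'I_(p + q) -> X} * {ffun 'I_(q + r) -> Y}) : {ffun 'I_m -> A} :=
  [ffun x => match split x with
    | inl i => (Some (f.1 (lshift q i)), None)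
    | inr y => (if split y is inl j then Some (f.1 (rshift p j)) else None, Some (f.2 y))
    end].

Lemma glue_l f i : glue f (lshift (q + r) i) = (Some (f.1 (lshift q i)), None).
Proof. by rewrite ffunE -[lshift _ i]/(unsplit (inl i)) unsplitK. Qed.

Lemma glue_m f j : glue f (rshift p (lshift r j)) = (Some (f.1 (rshift p j)), Some (f.2 (lshift r j))).
Proof.
rewrite ffunE -[rshift p _]/(unsplit (inr _)) unsplitK.
by rewrite -{1}[lshift _ j]/(unsplit (inl j)) unsplitK.
Qed.

Lemma glue_r f k : glue f (rshift p (rshift q k)) = (None, Some (f.2 (rshift q k))).
Proof.
rewrite ffunE -[rshift p _]/(unsplit (inr _)) unsplitK.
by rewrite -{1}[rshift _ k]/(unsplit (inr k)) unsplitK.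
Qed.

Lemma glue_inj : injective glue.
Proof.
move=> [f1 f2] [g1 g2] /ffunP e; congr (_, _); apply/ffunP=> x.
  rewrite -[x]splitK; case: (split x) => i /=.
    by have := e (lshift _ i); rewrite !glue_l => -[].
  by have := e (rshift p (lshift r i)); rewrite !glue_m => -[].
rewrite -[x]splitK; case: (split x) => i /=.
  by have := e (rshift p (lshift r i)); rewrite !glue_m => -[].
by have := e (rshift p (rshift q i)); rewrite !glue_r => -[].
Qed.

Lemma types_glue f : types (glue f) = type_word.
Proof.
apply/ffunP; apply: ord3_ind => i; rewrite ffunE.
- by rewrite glue_l type_word_l.
- by rewrite glue_m type_word_m.
- by rewrite glue_r type_word_r.
Qed.

Lemma glue_surj F : types F = type_word -> exists f, F = glue f.
Proof.
move=> /ffunP tF.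
have /fin_all_exists [f1 h1] : forall i : 'I_(p + q), exists a, (F
    match split i with inl i => lshift (q + r) i | inr j => rshift p (lshift r j) end).1 = Some a.
  move=> i; have := tF match split i with inl i => lshift (q + r) i | inr j => rshift p (lshift r j) end.
  case: (split i) => j; rewrite ?type_word_l ?type_word_m ffunE.
    by case: (F _) => [[a|] [b|]] // _; exists a.
  by case: (F _) => [[a|] [b|]] // _; exists a.
have /fin_all_exists [f2 h2] : forall y : 'I_(q + r), exists b, (F (rshift p y)).2 = Some b.
  move=> y; rewrite -[y]splitK; case: (split y) => j /=.
    have := tF (rshift p (lshift r j)); rewrite type_word_m ffunE.
    by case: (F _) => [[a|] [b|]] // _; exists b.
  have := tF (rshift p (rshift q j)); rewrite type_word_r ffunE.
  by case: (F _) => [[a|] [b|]] // _; exists b.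
exists (finfun f1, finfun f2); apply/ffunP; apply: ord3_ind => i.
- rewrite glue_l ffunE; have := h1 (lshift q i).
  rewrite -{1}[lshift _ i]/(unsplit (inl i)) unsplitK.
  have := tF (lshift (q + r) i); rewrite type_word_l ffunE.
  by case: (F _) => [[a|] [b|]] //= _ [->].
- rewrite glue_m !ffunE; have := h1 (rshift p i); have := h2 (lshift r i).
  rewrite -{1}[rshift _ i]/(unsplit (inr i)) unsplitK.
  have := tF (rshift p (lshift r i)); rewrite type_word_m ffunE.
  by case: (F _) => [[a|] [b|]] //= _ [->] [->].
- rewrite glue_r ffunE; have := h2 (rshift q i).
  have := tF (rshift p (rshift q i)); rewrite type_word_r ffunE.
  by case: (F _) => [[a|] [b|]] //= _ [->].
Qed.

Lemma heis_content_glue f :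
  heis_content (glue f) = has_content f.1 ca && has_content f.2 cb.
Proof.
rewrite /heis_content [X in [&& _, _ & X]](_ : _ = true) ?andbT; last first.
  by apply/forallP; apply: ord3_ind => i; rewrite ?glue_l ?glue_m ?glue_r.
congr (_ && _).
  apply: eq_forallb => a; congr (_ == _); rewrite card_ord3 /=.
  under eq_bigr do rewrite glue_l.
  under [X in (_ + (X + _))%N]eq_bigr do rewrite glue_m.
  under [X in (_ + (_ + X))%N]eq_bigr do rewrite glue_r.
  rewrite /= big1_eq addn0 -sum1_card big_split_ord /=.
  by congr addn; rewrite [RHS]big_mkcond; apply: eq_bigr => i _; rewrite inE; case: eqP => [[->]|ne]; case: eqP => // e; case: ne; rewrite e.
apply: eq_forallb => b; congr (_ == _); rewrite card_ord3 /=.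
under eq_bigr do rewrite glue_l.
under [X in (_ + (X + _))%N]eq_bigr do rewrite glue_m.
under [X in (_ + (_ + X))%N]eq_bigr do rewrite glue_r.
rewrite /= big1_eq add0n -sum1_card big_split_ord /=.
by congr addn; rewrite [RHS]big_mkcond; apply: eq_bigr => i _; rewrite inE; case: eqP => [[->]|ne]; case: eqP => // e; case: ne; rewrite e.
Qed.

Lemma glue_fcomp f (u : H) :
  fcomp (glue f) (heis_target u) =
  glue (fcomp f.1 (heis_source u).1, fcomp f.2 (heis_source u).2).
Proof.
apply/ffunP; apply: ord3_ind => i; rewrite fcompE /heis_target /heis_source /=.
- by rewrite iota_perm_lshift !glue_l fcompE iota_perm_lshift.
- rewrite iota_perm_rshift iota_perm_lshift !glue_m !fcompE.
  by rewrite iota_perm_lshift iota_perm_rshift.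
- by rewrite !iota_perm_rshift !glue_r !fcompE iota_perm_rshift.
Qed.

Lemma fixed_by_glue f (u : H) : fixed_by (glue f) (heis_target u) =
  fixed_by f.1 (heis_source u).1 && fixed_by f.2 (heis_source u).2.
Proof. by rewrite !fixed_byE glue_fcomp (inj_eq glue_inj); case: f. Qed.

Lemma cfdot_heisenberg (V : 'CF([set: 'S_(p + q)])) (W : 'CF([set: 'S_(q + r)]))
    (chi : 'CF([set: 'S_m])) :
  '[heisenberg V W, chi] = #|{: H}|%:R^-1 *
    \sum_(u : H) V (heis_source u).1 * W (heis_source u).2 * (chi (heis_target u))^*.
Proof.
rewrite /heisenberg cfdot_pushforward cfdotE cardsT; congr (_ * _).
rewrite (eq_bigl xpredT) => [|u]; last by rewrite inE.
by apply: eq_bigr => u _; rewrite !cf_pullbackE cf_tensorE.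
Qed.

(** The product is induced from the action of H_i on pairs of overlapping words, which is
    the action of H_i on the glued words.  These form one block of the set of words on
    which the whole symmetric group acts. *)
Lemma heisenberg_permc D (chi : 'CF([set: 'S_m])) : (m < D)%N ->
  '[heisenberg (permc (p + q) ca) (permc (q + r) cb), chi] =
  \sum_(g : {ffun A -> 'I_D} | heis_margins g) '[permc m (fun z => g z), chi].
Proof.
move=> mD; rewrite (sum_heis_margins _ mD) cfdot_heisenberg.
(* S F only depends on the orbit of F, so it may be summed over glued words only. *)
pose S F := \sum_(s | fixed_by F s) (chi s)^*.
have SJ F x : S (fcomp F x) = S F.
  rewrite /S (reindex_inj (conjg_inj x^-1%g)) /=; apply: eq_big => [s|s _].
    rewrite !fixed_byE fcompM -(inj_eq (can_inj (fcompK x^-1%g))) !fcompM.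
    by rewrite conjgE invgK !mulgA mulgKV mulVg mul1g fcomp1.
  by rewrite cfunJ ?inE.
have Hn0 : #|{: H}|%:R != 0 :> algC.
  rewrite pnatr_eq0 -lt0n; apply/card_gt0P; by exists 1%g.
have mn0 : (m`!)%:R != 0 :> algC by rewrite pnatr_eq0 -lt0n fact_gt0.
apply: (mulfI Hn0); rewrite mulVKf // mulrCA (sum_heis_content SJ) mulKf //.
transitivity (\sum_(F in [set glue f | f in
   [set f : {ffun 'I_(p + q) -> X} * {ffun 'I_(q + r) -> Y} |
     has_content f.1 ca && has_content f.2 cb]]) S F); last first.
  apply: eq_bigl => F; apply/imsetP/andP => [[f]|[hF /eqP tF]].
    by rewrite inE -heis_content_glue => hf ->; rewrite types_glue.
  by have [f e] := glue_surj tF; exists f; rewrite // inE -heis_content_glue -e.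
rewrite big_imset /=; last by move=> f g _ _; apply: glue_inj.
rewrite (eq_bigr (fun f => \sum_(u : H | fixed_by (glue f) (heis_target u)) (chi (heis_target u))^*)); last first.
  move=> f _; rewrite /S (sum_stab_type_word (fun s => (chi s)^*)) // => s.
  by rewrite -(types_glue f) !fixed_byE -types_fcomp => /eqP ->.
rewrite (exchange_big_dep xpredT) //=; apply: eq_bigr => u _.
rewrite !permcE -natrM /fix_count -cardX -sum1_card natr_sum mulr_suml.
apply: eq_big => [[f1 f2]|f _]; last by rewrite mul1r.
by rewrite !inE /= fixed_by_glue /= andbACA.
Qed.

End HeisenbergWords.

(** * Aguiar coefficients as signed sums of Kostka numbers *)

Lemma big_option (T : finType) (F : option T -> nat) :
  (\sum_x F x = F None + \sum_z F (Some z))%N.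
Proof.
rewrite (bigD1 None) //=; congr addn.
rewrite (reindex_omap Some id) /=; last by case.
by apply: eq_bigl => z; rewrite eqxx.
Qed.

Lemma cfdot_permc_frob n m (B : finType) (g : B -> nat) (k : 'X_{1..n}) :
  '[permc m g, frob m k] = '[frob m k, permc m g].
Proof.
rewrite !cfdotE; congr (_ * _); apply: eq_bigr => s _.
by rewrite frob_conj permc_conj mulrC.
Qed.

Lemma heis_margins_sum (X Y : finType) (ca : X -> nat) (cb : Y -> nat) D
    (g : {ffun option X * option Y -> 'I_D}) : heis_margins ca cb g ->
  (maxn (\sum_a ca a) (\sum_b cb b) <= \sum_z g z <= \sum_a ca a + \sum_b cb b)%N.
Proof.
case/and3P => /forallP ha /forallP hb /eqP h0.
have eT : (\sum_z g z = \sum_x \sum_y g (x, y))%N by rewrite pair_bigA /=; apply: eq_bigr => -[].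
have ea : (\sum_a ca a = \sum_a (g (Some a, None) + \sum_b g (Some a, Some b)))%N.
  by apply: eq_bigr => a _; rewrite -(eqP (ha a)) big_option.
have eb : (\sum_b cb b = \sum_b g (None, Some b) + \sum_a \sum_b g (Some a, Some b))%N.
  rewrite [in RHS]exchange_big -big_split /=.
  by apply: eq_bigr => b _; rewrite -(eqP (hb b)) big_option.
rewrite eT ea eb big_option (big_option (fun y => nat_of_ord (g (None, y)))) h0 add0n.
have -> : (\sum_z \sum_y g (Some z, y) = \sum_a (g (Some a, None) + \sum_b g (Some a, Some b)))%N.
  by apply: eq_bigr => a _; rewrite big_option.
by rewrite !big_split /=; lia.
Qed.

Section AguiarFormula.

Variables n1 n2 n3 : nat.
Local Notation A := (option 'I_n1.+1 * option 'I_n2.+1)%type.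

Definition shifted n (L : 'X_{1..n.+1}) (w : 'S_n.+1) : 'I_n.+1 -> nat :=
  fun i => (mnm_act (L + rho n.+1) w - rho n.+1)%MM i.

Definition admissible n (L : 'X_{1..n.+1}) (w : 'S_n.+1) :=
  (rho n.+1 <= mnm_act (L + rho n.+1) w)%MM.

(** The number of tableaux of shape [N] in the alphabet of the x_a, y_b and x_a y_b, with
    x-content [ca] and y-content [cb].  The bound [D] on the multiplicities only serves to
    have a finite type of contents. *)
Definition weight_count D (ca : 'I_n1.+1 -> nat) (cb : 'I_n2.+1 -> nat) (N : 'X_{1..n3.+1}) : algC :=
  \sum_(g : {ffun A -> 'I_D} | heis_margins ca cb g) kostka (fun z => g z) (N + rho n3.+1)%MM.

Lemma sum_shifted n (L : 'X_{1..n.+1}) w : admissible L w -> (\sum_i shifted L w i)%N = mdeg L.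
Proof.
move=> adm; apply/eqP; rewrite /shifted -mdegE -(eqn_add2r (mdeg (rho n.+1))) -mdegD submK //.
by rewrite mdeg_mnm_act mdegD.
Qed.

(** When the degree of [nu] is out of range, the left hand side is 0 by convention; the
    right hand side is too, because no word has contents of these sizes. *)
Lemma aguiar_formula lam mu nu D :
  is_part lam -> is_part mu -> is_part nu ->
  (size lam <= n1.+1)%N -> (size mu <= n2.+1)%N -> (size nu <= n3.+1)%N ->
  (sumn nu < D)%N ->
  (aguiar lam mu nu)%:R =
  \sum_(w1 | admissible (part_mnm n1 lam) w1) \sum_(w2 | admissible (part_mnm n2 mu) w2)
    (-1) ^+ w1 * (-1) ^+ w2 *
    weight_count D (shifted (part_mnm n1 lam) w1) (shifted (part_mnm n2 mu) w2) (part_mnm n3 nu).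
Proof.
move=> pl pm pn sl sm sn nD.
have snu : strict (part_mnm n3 nu + rho n3.+1)%MM.
  exact: (strict_addrho (part_mnm_decr pn)).
have dl : mdeg (part_mnm n1 lam) = sumn lam by apply: mdeg_part_mnm.
have dm : mdeg (part_mnm n2 mu) = sumn mu by apply: mdeg_part_mnm.
have dn : mdeg (part_mnm n3 nu) = sumn nu by apply: mdeg_part_mnm.
rewrite /aguiar; case: ifP => [|out]; last first.
  rewrite big1 // => w1 h1; rewrite big1 // => w2 h2; rewrite /weight_count big1 ?mulr0 // => g hg.
  apply/eqP; apply: contraFT out => /(kostka_neq0_degree snu).
  rewrite mdegD addnC dn => /addnI ->.
  by have := heis_margins_sum hg; rewrite !sum_shifted // dl dm.
rewrite geq_max -andbA => /and3P[h1 h2 h3].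
set p := (_ - _)%N; set q := (_ + _ - _)%N; set r := (_ - sumn lam)%N.
have ek : sumn lam = (p + q)%N by rewrite /p /q; lia.
have el : sumn mu = (q + r)%N by rewrite /q /r; lia.
have ei : sumn nu = (p + (q + r))%N by rewrite /p /q /r; lia.
rewrite heis_multE (specht_char_frob pl sl ek) (specht_char_frob pm sm el) (specht_char_frob pn sn ei).
set chi := frob (p + (q + r)) _; rewrite cfdot_heisenberg.
rewrite (eq_bigr (fun u => \sum_(w1 | admissible (part_mnm n1 lam) w1)
  \sum_(w2 | admissible (part_mnm n2 mu) w2) (-1) ^+ w1 * (-1) ^+ w2 *
   (permc (p + q) (shifted (part_mnm n1 lam) w1) (heis_source u).1 *
    permc (q + r) (shifted (part_mnm n2 mu) w2) (heis_source u).2 * (chi (heis_target u))^*))); last first.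
  move=> u _; rewrite /frob !sum_cfunE mulr_suml mulr_suml; apply: eq_bigr => w1 _.
  rewrite mulr_sumr mulr_suml; apply: eq_bigr => w2 _.
  by rewrite !cfunE mulrACA !mulrA.
rewrite exchange_big mulr_sumr /=; apply: eq_bigr => w1 adm1.
rewrite exchange_big mulr_sumr /=; apply: eq_bigr => w2 adm2.
rewrite -mulr_sumr mulrCA -cfdot_heisenberg; congr (_ * _).
rewrite (@heisenberg_permc _ _ _ _ _ _ _ _ _ D).
- apply: eq_bigr => g _; rewrite cfdot_permc_frob cfdot_frob //.
  by rewrite mdegD dn addnC -ei.
- by rewrite sum_shifted // dl.
- by rewrite sum_shifted // dm.
by rewrite -ei.
Qed.

End AguiarFormula.

(** * Stability *)

Lemma heis_margins_add (X Y : finType) (ca ca' : X -> nat) (cb cb' : Y -> nat) D a0 b0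
    (g g' : {ffun option X * option Y -> 'I_D}) :
  (forall a, ca' a = ca a + (a == a0))%N -> (forall b, cb' b = cb b + (b == b0))%N ->
  (forall z, g' z = g z + (z == (Some a0, Some b0)) :> nat)%N ->
  heis_margins ca' cb' g' = heis_margins ca cb g.
Proof.
move=> hca hcb hg; congr [&& _, _ & _]; last by rewrite hg addn0.
  apply: eq_forallb => a; rewrite hca; under eq_bigr do rewrite hg.
  rewrite big_split /= [X in (_ + X)%N](_ : _ = (a == a0) :> nat) ?eqn_add2r //.
  rewrite (bigD1 (Some b0)) //= xpair_eqE eqxx andbT big1 ?addn0 // => y ny.
  by rewrite xpair_eqE (negbTE ny) andbF.
apply: eq_forallb => b; rewrite hcb; under eq_bigr do rewrite hg.
rewrite big_split /= [X in (_ + X)%N](_ : _ = (b == b0) :> nat) ?eqn_add2r //.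
rewrite (bigD1 (Some a0)) //= xpair_eqE eqxx big1 ?addn0 // => y ny.
by rewrite xpair_eqE (negbTE ny).
Qed.

Lemma heis_margins_le (X Y : finType) (ca : X -> nat) (cb : Y -> nat) D a b
    (g : {ffun option X * option Y -> 'I_D}) :
  heis_margins ca cb g -> (g (Some a, Some b) <= ca a)%N.
Proof.
by case/and3P => /forallP/(_ a)/eqP <- _ _; rewrite (bigD1 (Some b)) //= leq_addr.
Qed.

Section Stability.

Variables n1 n2 n3 : nat.
Local Notation A := (option 'I_n1.+1 * option 'I_n2.+1)%type.

Lemma card_cross (a0 : 'I_n1.+1) (b0 : 'I_n2.+1) :
  #|[pred z : A | (z.1 == Some a0) || (z.2 == Some b0)]| = (n1.+1 + n2.+1 + 1)%N.
Proof.
rewrite -sum1_card (bigID (fun z : A => z.1 == Some a0)) /=.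
rewrite (reindex_onto (fun y => (Some a0, y)) snd) /=; last first.
  by move=> [x y] /= /andP[_ /eqP ->].
rewrite (reindex_onto (fun x => (x, Some b0)) fst) /=; last first.
  by move=> [x y]; rewrite ?inE /= => /andP[/orP[/eqP ->|/eqP ->]]; rewrite ?eqxx.
rewrite (eq_bigl xpredT) => [|y]; last by rewrite !inE !eqxx.
rewrite [X in (_ + X)%N](eq_bigl (fun x => x != Some a0)) => [|x]; last first.
  by rewrite !inE !eqxx orbT /= andbT.
by rewrite sum1_card sum_nat_const muln1 cardC1 !card_option !card_ord /=; lia.
Qed.

(** The letter x_(a0) y_(b0) is counted both as an occurrence of x_(a0) and of y_(b0). *)
Lemma cross_sum (ca : 'I_n1.+1 -> nat) (cb : 'I_n2.+1 -> nat) D (g : {ffun A -> 'I_D}) a0 b0 :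
  heis_margins ca cb g ->
  (\sum_(z : A | (z.1 == Some a0) || (z.2 == Some b0)) g z + g (Some a0, Some b0) =
   ca a0 + cb b0)%N.
Proof.
case/and3P => /forallP/(_ a0)/eqP <- /forallP/(_ b0)/eqP <- _.
rewrite (bigID (fun z : A => z.1 == Some a0)) /= -addnA; congr addn.
  rewrite (reindex_onto (fun y => (Some a0, y)) snd) /=; last first.
    by move=> [x y] /= /andP[_ /eqP ->].
  by apply: eq_bigl => y; rewrite !eqxx.
rewrite [RHS](bigD1 (Some a0)) //= addnC; congr addn.
rewrite (reindex_onto (fun x => (x, Some b0)) fst) /=; last first.
  by move=> [x y]; rewrite ?inE /= => /andP[/orP[/eqP ->|/eqP ->]]; rewrite ?eqxx.
by apply: eq_bigl => x; rewrite !eqxx orbT /= andbT.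
Qed.

Lemma leq_sum_ord_nat n K (F : nat -> nat) :
  (\sum_(i < n | i < K) F i <= \sum_(0 <= i < K) F i)%N.
Proof.
rewrite big_mkord (big_ord_widen_cond (maxn n K) (fun i => i < K)%N F) ?leq_maxl //.
rewrite (big_ord_widen (maxn n K) F) ?leq_maxr // [X in (X <= _)%N]big_mkcond [X in (_ <= X)%N]big_mkcond.
by apply: leq_sum => i _; case: ltnP => //=; case: ifP.
Qed.

Variables (L : 'X_{1..n1.+1}) (M : 'X_{1..n2.+1}) (N : 'X_{1..n3.+1}).
Hypothesis N_decr : forall i j : 'I_n3.+1, (i <= j)%N -> (N j <= N i)%N.

Local Notation e0 := (U_(ord0))%MM.

(** Truncated subtraction is harmless, as [rho] is largest at the first index. *)
Lemma shifted_add n (K : 'X_{1..n.+1}) (w : 'S_n.+1) i :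
  shifted (K + e0) w i = (shifted K w i + (i == w^-1%g ord0))%N.
Proof.
rewrite /shifted !mnmBE !mnm_actE !mnmDE mnm1E.
have -> : (i == w^-1%g ord0) = (ord0 == w i).
  by rewrite -(inj_eq (@perm_inj _ w)) permKV eq_sym.
case: eqP => [<-|_]; last by rewrite !addn0.
by rewrite !rhoE /=; have := ltn_ord i; lia.
Qed.

Lemma admissible_add n (K : 'X_{1..n.+1}) (w : 'S_n.+1) :
  admissible (K + e0) w = admissible K w.
Proof.
apply/mnm_lepP/mnm_lepP => h i; have := h i; rewrite !mnm_actE !mnmDE ?mnm1E.
  case: eqP => [<-|_]; last by rewrite addn0.
  by rewrite !rhoE /=; lia.
by move/leq_trans; apply; rewrite leq_add2r leq_addr.
Qed.

(** The entry that receives the first part only gets larger, again since [rho] is largest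
    at the first index. *)
Lemma shifted_first n (K : 'X_{1..n.+1}) (w : 'S_n.+1) : (K ord0 <= shifted K w (w^-1%g ord0))%N.
Proof. by rewrite /shifted mnmBE mnm_actE mnmDE permKV !rhoE /=; lia. Qed.

(** The bijection adds one letter x_(a0) y_(b0), where [a0] and [b0] receive the first parts
    of [L] and [M].  The second hypothesis forces at least [s] of these letters before, and
    more than [s] after, where [s] bounds the rows below the first one. *)
Lemma weight_count_stable D (w1 : 'S_n1.+1) (w2 : 'S_n2.+1) (s : nat) :
  (forall i : 'I_n3.+1, i != ord0 -> (N i <= s)%N) ->
  (\sum_(i < n3.+1 | i < n1.+1 + n2.+1 + 1) N i + s <= L ord0 + M ord0)%N ->
  (mdeg L + 1 < D)%N -> admissible L w1 ->
  weight_count D (shifted (L + e0) w1) (shifted (M + e0) w2) (N + e0)%MM =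
  weight_count D (shifted L w1) (shifted M w2) N.
Proof.
move=> Ns hs LD adm1.
set a0 := (w1^-1)%g ord0; set b0 := (w2^-1)%g ord0.
pose z0 : A := (Some a0, Some b0).
have sN : strict (N + rho n3.+1)%MM by apply: strict_addrho.
have Ne_decr (i j : 'I_n3.+1) : (i <= j)%N -> ((N + e0)%MM j <= (N + e0)%MM i)%N.
  move=> ij; rewrite !mnmDE !mnm1E leq_add ?N_decr //.
  by case: (ord0 =P j) => // e; move: ij; rewrite -e leqn0 -[0%N]/(nat_of_ord (ord0 : 'I_n3.+1)) eq_sym; move/eqP/val_inj => <-.
have sNe : strict (N + e0 + rho n3.+1)%MM by apply: strict_addrho.
(* Lower bound for the number of letters z0 in a tableau of shape K. *)
have lower (K : 'X_{1..n3.+1}) ca cb (g : {ffun A -> 'I_D}) : strict (K + rho n3.+1)%MM ->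
   heis_margins ca cb g -> kostka (fun z => g z) (K + rho n3.+1)%MM != 0 ->
   (ca a0 + cb b0 <= g z0 + \sum_(i < n3.+1 | i < n1.+1 + n2.+1 + 1) K i)%N.
  move=> sK hg; rewrite -(cross_sum a0 b0 hg) addnC leq_add2l => h.
  have := kostka_neq0_dominance [pred z : A | (z.1 == Some a0) || (z.2 == Some b0)] sK h.
  rewrite card_cross => /leq_trans; apply; apply: leq_sum => i _.
  by rewrite mnmDE addnK.
have K0 : (0 < n1.+1 + n2.+1 + 1)%N by rewrite addn1.
move: (n1.+1 + n2.+1 + 1)%N K0 hs lower => K K0 hs lower.
have c1 := shifted_first L w1; have c2 := shifted_first M w2.
have ca_add := shifted_add L w1; have cb_add := shifted_add M w2.
rewrite /weight_count (bigID (fun g : {ffun A -> 'I_D} => s < g z0)%N) /=.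
rewrite [X in _ + X]big1 ?addr0; last first.
  move=> g /andP[hg]; apply: contraNeq => h; have := lower _ _ _ _ sNe hg h.
  rewrite ca_add cb_add !eqxx (bigD1 ord0) //= mnmDE mnm1E eqxx.
  rewrite (eq_bigr N) => [|i /andP[_ i0]]; last first.
    by rewrite mnmDE mnm1E eq_sym (negbTE i0) addn0.
  move: hs; rewrite (bigD1 ord0) //=; rewrite -/a0 -/b0 in c1 c2 *.
  lia.
rewrite [RHS](bigID (fun g : {ffun A -> 'I_D} => s <= g z0)%N) /=.
rewrite [X in _ = _ + X]big1 ?addr0; last first.
  move=> g /andP[hg]; apply: contraNeq => h; have := lower _ _ _ _ sN hg h.
  rewrite -/a0 -/b0 in c1 c2 *; lia.
clear lower; case: D LD => [|D] // LD.
(* [inord] stays in range wherever it matters, since the number of letters z0 is at most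
   the degree of L, which is smaller than D. *)
pose up (g : {ffun A -> 'I_D.+1}) : {ffun A -> 'I_D.+1} :=
  [ffun z => if z == z0 then inord (g z).+1 else g z].
pose down (g : {ffun A -> 'I_D.+1}) : {ffun A -> 'I_D.+1} :=
  [ffun z => if z == z0 then inord (g z).-1 else g z].
have upE (g : {ffun A -> 'I_D.+1}) z : (g z0 < D)%N -> up g z = (g z + (z == z0))%N :> nat.
  by move=> h; rewrite ffunE; case: eqP => [->|]; rewrite ?addn0 // inordK ?addn1.
have downE (g : {ffun A -> 'I_D.+1}) z : down g z = (g z - (z == z0))%N :> nat.
  rewrite ffunE; case: eqP => [->|]; rewrite ?subn0 // inordK ?subn1 //.
  by apply: leq_ltn_trans (leq_pred _) (ltn_ord _).
rewrite (reindex_onto up down) /=; last first.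
  move=> g /andP[_ hg]; apply/ffunP=> z; apply: val_inj => /=.
  have g0 : (0 < g z0)%N by apply: leq_ltn_trans hg.
  have lt : (down g z0 < D)%N by rewrite downE eqxx; have := ltn_ord (g z0); lia.
  by rewrite upE // downE; case: eqP => [->|_]; lia.
have marg (g : {ffun A -> 'I_D.+1}) : (g z0 < D)%N ->
   heis_margins (shifted (L + e0) w1) (shifted (M + e0) w2) (up g) =
   heis_margins (shifted L w1) (shifted M w2) g.
  by move=> h; apply: (heis_margins_add ca_add cb_add) => z; apply: upE.
have ltD (g : {ffun A -> 'I_D.+1}) : heis_margins (shifted L w1) (shifted M w2) g -> (g z0 < D)%N.
  move/(heis_margins_le a0 b0) => h; apply: leq_ltn_trans h _.
  rewrite -ltnS -addn1 (leq_ltn_trans _ LD) // leq_add2r -(sum_shifted adm1).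
  by rewrite (bigD1 a0) //= leq_addr.
apply: eq_big => [g|g].
  apply/andP/andP => [[/andP[h1 h2] /eqP e]|[h1 h2]].
    have gD : (g z0 < D)%N.
      rewrite ltn_neqAle -ltnS ltn_ord andbT; apply/eqP => gz.
      move: h2; rewrite ffunE eqxx gz val_insubd ltnn /=; lia.
    by rewrite -marg // h1; split=> //; move: h2; rewrite upE // eqxx addn1.
  have gD := ltD _ h1; rewrite marg // h1 upE // eqxx addn1 ltnS h2; split=> //.
  by apply/eqP/ffunP=> z; apply: val_inj; rewrite /= downE upE // addnK.
case/andP => /andP[h1 h2] /eqP e.
have gD : (g z0 < D)%N.
  rewrite ltn_neqAle -ltnS ltn_ord andbT; apply/eqP => gz.
  move: h2; rewrite ffunE eqxx gz val_insubd ltnn /=; lia.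
have -> : (N + e0 + rho n3.+1 = N + rho n3.+1 + e0)%MM.
  by rewrite -addmA [(e0 + _)%MM]addmC addmA.
apply: (@kostka_first_part_add _ _ _ _ _ z0) => //.
- move=> i i0; rewrite mnmDE; have := Ns i i0; move: h2; rewrite upE // eqxx addn1 ltnS.
  have : (rho n3.+1 i < rho n3.+1 ord0)%N by apply: strict_rho; rewrite lt0n.
  lia.
- by rewrite upE // eqxx addn1.
by move=> z nz; rewrite upE // (negbTE nz) addn0.
Qed.

End Stability.

Lemma part_mnm_add_row n lam d :
  part_mnm n (part_add lam (part_row d)) = (part_mnm n lam + U_(ord0) *+ d)%MM.
Proof.
apply/mnmP=> i; rewrite mnmDE mulmnE mnm1E !mnmE.
have := @part_add_part lam (part_row d) i.+1 isT; rewrite /part /= => ->; congr addn.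
rewrite /part_row; case: i => [[|i] hi]; case: d => [|d] //=; rewrite ?muln0 ?mul1n //.
by rewrite nth_nil mul0n.
Qed.

Lemma part_add_rowE lam d : part_add lam (part_row d) =
  if d == 0%N then lam else ((head 0 lam + d)%N :: behead lam).
Proof.
case: d => [|d] /=.
  apply: (@eq_from_nth _ 0%N); rewrite size_mkseq maxn0 // => i hi.
  by rewrite nth_mkseq ?maxn0 // nth_nil addn0.
apply: (@eq_from_nth _ 0%N) => [|i].
  by rewrite size_mkseq /=; case: lam => //= x l; rewrite maxnSS maxn0.
rewrite size_mkseq => hi; rewrite nth_mkseq //.
by case: lam hi => [|x l]; case: i => [|i] //= _; rewrite ?nth_nil ?addn0.
Qed.

Lemma is_part_add_row lam d : is_part lam -> is_part (part_add lam (part_row d)).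
Proof.
rewrite part_add_rowE; case: d => // d; case: lam => [|x l] //= => /andP[/= srt].
rewrite inE negb_or => /andP[x0 l0]; apply/andP; split => /=.
  by case: l srt {l0} => //= y l /andP[yx ->]; rewrite andbT (leq_trans yx) ?leq_addr.
by rewrite inE negb_or l0 andbT; lia.
Qed.

Lemma size_add_row lam d n : (size lam <= n.+1)%N ->
  (size (part_add lam (part_row d)) <= n.+1)%N.
Proof. by move=> h; rewrite size_mkseq geq_max h /part_row; case: d. Qed.

Lemma sumn_add_row lam d : sumn (part_add lam (part_row d)) = (sumn lam + d)%N.
Proof.
rewrite part_add_rowE; case: d => [|d] /=; first by rewrite addn0.
by case: lam => [|x l] //=; lia.
Qed.

Theorem theorem4p5 (lam mu nu : seq nat) (n1 n2 : nat)
    (hlam : is_part lam) (hmu : is_part mu) (hnu : is_part nu)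
    (hn1 : (2 <= n1)%N) (hn2 : (2 <= n2)%N)
    (hslam : (size lam <= n1)%N) (hsmu : (size mu <= n2)%N)
    (hsnu : (size nu <= n1 * n2 + n1 + n2)%N) :
  let bound : int :=
    - (part lam 1)%:Z - (part mu 1)%:Z + (part nu 1)%:Z + 2 * (part nu 2)%:Z
    + \sum_(1 <= k < n1 + n2) (part nu (k + 2))%:Z in
  let a (d : nat) : nat :=
    aguiar (part_add lam (part_row d)) (part_add mu (part_row d))
           (part_add nu (part_row d)) in
  forall d d' : nat, bound <= d%:Z -> bound <= d'%:Z -> a d = a d'.
Proof.
move=> bound a; clear hsnu.
have step d : bound <= d%:Z -> a d.+1 = a d.
  case: n1 hn1 hslam @bound => [|m1] // _ hsl; case: n2 hn2 hsmu => [|m2] // _ hsm bound hd.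
  (* Any bound D above all the multiplicities that occur for d and d.+1 will do. *)
  pose m3 := size nu; pose D := (sumn lam + sumn nu + d).+3.
  have hsn : (size nu <= m3.+1)%N by rewrite /m3.
  apply/eqP; rewrite -(eqr_nat algC); apply/eqP.
  rewrite (@aguiar_formula m1 m2 m3 _ _ _ D) ?is_part_add_row ?size_add_row ?sumn_add_row //; last by rewrite /D; lia.
  rewrite (@aguiar_formula m1 m2 m3 _ _ _ D) ?is_part_add_row ?size_add_row ?sumn_add_row //; last by rewrite /D; lia.
  rewrite !part_mnm_add_row.
  have mS n (K : 'X_{1..n.+1}) : (K + U_(ord0) *+ d.+1 = K + U_(ord0) *+ d + U_(ord0))%MM.
    by rewrite mulmSr addmA.
  rewrite !mS -!part_mnm_add_row.
  apply: eq_big => [w1|w1]; first by rewrite admissible_add.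
  rewrite admissible_add => adm1; apply: eq_big => [w2|w2 adm2]; first by rewrite admissible_add.
  congr (_ * _); apply: (@weight_count_stable _ _ _ _ _ _ _ _ _ _ (nth 0 nu 1)%N).
  - exact/part_mnm_decr/is_part_add_row.
  - move=> i i0; rewrite part_mnm_add_row mnmDE mulmnE mnm1E eq_sym (negbTE i0) mul0n addn0 mnmE.
    by apply: part_nth_decr => //; rewrite lt0n.
  (* The bound is minus lam_1 - mu_1, plus nu_2, plus the sum of the first n1 + n2 + 1 parts of nu. *)
  - have bE : bound = - (nth 0%N lam 0)%:Z - (nth 0%N mu 0)%:Z +
        (nth 0%N nu 1)%:Z + (\sum_(0 <= i < m1.+1 + m2.+1 + 1) nth 0%N nu i)%N%:Z.
      rewrite addn1 big_nat_recl //= big_ltn // /bound /part /=.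
      rewrite (eq_bigr (fun k => (nth 0%N nu k.+1)%:Z)) => [|k _]; last by rewrite addn2.
      rewrite -(big_morph Posz PoszD (erefl _)) !PoszD.
      by move: (Posz (\sum_(_ <= _ < _) _)%N) => S; lia.
    rewrite !part_mnm_add_row !mnmDE !mulmnE !mnm1E !mnmE eqxx mul1n.
    have hsum : (\sum_(i < m3.+1 | i < m1.+1 + m2.+1 + 1) (part_mnm m3 nu + U_(ord0) *+ d)%MM i <=
        \sum_(0 <= i < m1.+1 + m2.+1 + 1) nth 0%N nu i + d)%N.
      rewrite [X in (X <= _)%N](eq_bigr (fun i : 'I_m3.+1 => nth 0%N nu i + (ord0 == i) * d)%N) => [|i _]; last first.
        by rewrite mnmDE mulmnE mnm1E [part_mnm _ _ _]mnmE.
      rewrite big_split leq_add ?(leq_sum_ord_nat _ _ (nth 0%N nu)) //=.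
      rewrite (bigD1 ord0) ?addn1 //= mul1n big1 ?addn0 // => i /andP[_ i0].
      by rewrite eq_sym (negbTE i0).
    apply: leq_trans (leq_add hsum (leqnn _)) _ => /=; clear hsum.
    by move: hd; rewrite bE; move: (\sum_(_ <= _ < _) _)%N => S; lia.
  - by rewrite (@mdeg_part_mnm _ (sumn lam + d)) ?is_part_add_row ?size_add_row ?sumn_add_row // /D; lia.
  exact: adm1.
have stab d k : bound <= d%:Z -> a (d + k)%N = a d.
  move=> hd; elim: k => [|k IH]; first by rewrite addn0.
  rewrite addnS step //; apply: le_trans hd _; by rewrite lez_nat leq_addr.
move=> d d' hd hd'; case: (leqP d d') => [h|/ltnW h].
  by rewrite -(subnKC h) stab.
by rewrite -(subnKC h) stab.
Qed.
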